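(* Let $x\ge 0$ be a fixed real number and let $z$ be fixed with $p<z<1$. Then, as $N\to\infty$ through integers for which $n=zN$ is an integer, with $\varepsilon=1/N$, $$K_n(x)\sim \frac{\varepsilon^{1/2}}{\sqrt{2\pi}\sqrt{z(1-z)}}\cos(\pi x)\left(\frac{z-p}{p}\right)^{x}\exp\left[\frac{\phi_0(z)}{\varepsilon}\right]-\frac{\varepsilon}{\pi}\,\frac{x\,\Gamma(x)}{z-p}\,\sin(\pi x)\left(\frac{q\varepsilon}{z-p}\right)^{x}\exp\left[\frac{(z-1)\ln(q)+\pi \mathrm{i} z}{\varepsilon}\right],$$ i.e. the ratio of the two sides tends to $1$, where $$\phi_0(z)=(z-1)\ln(1-z)-z\ln(z)+z\ln(-p),\qquad \ln(-p)=\ln(p)+\pi \mathrm{i}.$$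
   Context: Fix real $0<p,q<1$ with $p+q=1$. For integers $n,N\ge 0$ and real $x$, the Krawtchouk polynomial is $$K_n(x)=K_n(x,N,p,q)=\sum_{k=0}^{n}\binom{x}{k}\binom{N-x}{n-k}q^{k}(-p)^{n-k},$$ where $\binom{a}{k}=a(a-1)\cdots(a-k+1)/k!$ for real $a$ and integer $k\geq 0$. $\Gamma$ is the Gamma function, and $x\Gamma(x)$ is read as $\Gamma(x+1)$ (so it equals $1$ at $x=0$). *)

(* Defs.v *)
(* Stdlib real numbers with Coquelicot limits, integrals and complex numbers. *)
From Stdlib Require Import Reals Factorial.
From Coquelicot Require Import Coquelicot.

Open Scope R_scope.

Fixpoint falling (a : R) (k : nat) : R :=
  match k with
  | O => 1
  | S j => falling a j * (a - INR j)
  end.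

Definition gbinom (a : R) (k : nat) : R := falling a k / INR (fact k).

(* [sum_f_R0 f n] is the sum of [f k] over [0 <= k <= n]; in particular the
   truncated subtraction [n - k] is the true one. *)
Definition krawtchouk (p q : R) (n N : nat) (x : R) : R :=
  sum_f_R0
    (fun k => gbinom x k * gbinom (INR N - x) (n - k) * q ^ k * (- p) ^ (n - k))
    n.

(* Euler's integral over (0, +oo), improper at both ends; it converges exactly
   for [0 < s]. *)
Definition Gamma (s : R) : R :=
  RInt_gen (fun t => Rpower t (s - 1) * exp (- t))
    (at_right 0) (Rbar_locally p_infty).

Definition Cexp (w : C) : C :=
  (exp (Re w) * cos (Im w), exp (Re w) * sin (Im w)).

(* The logarithm of [- p] for [0 < p], on the branch with imaginary part pi. *)
Definition ln_opp (p : R) : C := (RtoC (ln p) + RtoC PI * Ci)%C.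

Definition phi0 (p z : R) : C :=
  (RtoC ((z - 1) * ln (1 - z)) - RtoC (z * ln z) + RtoC z * ln_opp p)%C.

(* The right-hand side of the expansion, with [x * Gamma x] read as
   [Gamma (x + 1)] so that it makes sense at [x = 0].  Both bases of the real
   powers [Rpower] are positive when [0 < p < z], [0 < q] and [0 < eps]. *)
Definition krawtchouk_asymptotic (p q x z eps : R) : C :=
  (RtoC (sqrt eps / (sqrt (2 * PI) * sqrt (z * (1 - z)))
         * cos (PI * x) * Rpower ((z - p) / p) x)
     * Cexp (phi0 p z / RtoC eps)
   - RtoC (eps / PI * (Gamma (x + 1) / (z - p))
           * sin (PI * x) * Rpower (q * eps / (z - p)) x)
     * Cexp ((RtoC ((z - 1) * ln q) + RtoC PI * Ci * RtoC z) / RtoC eps))%C.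

(* Main.v *)
Require Import Defs.
From Stdlib Require Import Reals ZArith Factorial Lra Lia Psatz.
From Coquelicot Require Import Coquelicot.

Open Scope R_scope.

(** The generating function of the Krawtchouk polynomials in [w] is
    [(1 + q w)^x (1 - p w)^(N - x)]. The first term of the expansion comes from its
    saddle point, the second one from its branch point [w = - 1 / q], which exists unless
    [x] is a natural number. Since the Kullback-Leibler divergence of [z] from [p] is
    positive ([saddle_exponent_lt]), the first term is then exponentially smaller than the
    second one. Two regimes result, according to whether [sin (PI * x)] vanishes; both
    are proved from the defining sum, without contour integrals.

    If [x = m] is a natural number, the second term is zero and the sum has at most
    [m + 1] nonzero terms. Divided by [gbinom N n * (- p)^n], each of them has a limit
    and the limits add up to [((p - z) / p)^m] ([krawtchouk_integer_ratio]); Stirling's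
    formula for [gbinom N n] ([central_binomial_asymptotic]) then gives the first term.

    If [x] is not an integer, write [j = n - k]. The sum becomes [(-1)^n q^n / q^N] times
    the average, over the binomial law of parameters [N] and [p], of
    [(-1)^(n-j) gbinom x (n-j)] times [gbinom (N-x) j / gbinom N j]
    ([krawtchouk_as_average]). The law concentrates at [j = p N], by an exponential
    moment bound ([binomial_concentration]), and there the averaged quantity is
    asymptotic to a constant times [N^(-x-1)] ([averaged_term_limit]). The second term
    follows, its exponential factor being [q^n / q^N].

    The constant rests on the growth of [(-1)^k gbinom x k], that is, of
    [- Gamma (x + 1) sin (PI x) / PI] times [k^(-x-1)] ([gbinom_asymptotic]). It is the
    quotient of Euler's product for the sine ([euler_sine_product]), obtained from
    integrals of [cos (2 x t) cos^m t], by Gauss's product for [Gamma (x + 1)]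
    ([gauss_product]), obtained from Euler's integral by comparing [t^s] with its tangent
    lines. The sine product at [1/2] is Wallis's product, and gives the constant in
    Stirling's formula ([stirling]). *)

(** * Real-valued limits along a filter *)

Section FilterLimits.
Context {T : Type} {F : (T -> Prop) -> Prop} {FF : Filter F}.
Implicit Types f g : T -> R.

Lemma flim_mult f g (a b : R) :
  filterlim f F (locally a) -> filterlim g F (locally b) ->
  filterlim (fun t => f t * g t) F (locally (a * b)).
Proof.
  intros Hf Hg.
  exact (filterlim_comp_2 _ _ Rmult Hf Hg (filterlim_mult (K := R_AbsRing) a b)).
Qed.

Lemma flim_plus f g (a b : R) :
  filterlim f F (locally a) -> filterlim g F (locally b) ->
  filterlim (fun t => f t + g t) F (locally (a + b)).
Proof.
  intros Hf Hg.
  exact (filterlim_comp_2 _ _ Rplus Hf Hg (filterlim_plus (V := R_NormedModule) a b)).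
Qed.

Lemma flim_continuous (phi : R -> R) f (a : R) :
  continuous phi a -> filterlim f F (locally a) ->
  filterlim (fun t => phi (f t)) F (locally (phi a)).
Proof. intros Hphi Hf. exact (filterlim_comp _ _ _ f phi F _ _ Hf Hphi). Qed.

Lemma flim_opp f (a : R) :
  filterlim f F (locally a) -> filterlim (fun t => - f t) F (locally (- a)).
Proof.
  intros Hf. apply (flim_continuous Ropp); [| exact Hf].
  apply (ex_derive_continuous Ropp); auto_derive; exact I.
Qed.

Lemma flim_inv f (a : R) :
  a <> 0 -> filterlim f F (locally a) ->
  filterlim (fun t => / f t) F (locally (/ a)).
Proof.
  intros Ha Hf. apply (flim_continuous Rinv); [| exact Hf].
  apply (ex_derive_continuous Rinv); auto_derive; exact Ha.
Qed.

Lemma flim_minus f g (a b : R) :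
  filterlim f F (locally a) -> filterlim g F (locally b) ->
  filterlim (fun t => f t - g t) F (locally (a - b)).
Proof. intros Hf Hg. apply flim_plus; [exact Hf | apply flim_opp, Hg]. Qed.

Lemma flim_div f g (a b : R) :
  b <> 0 -> filterlim f F (locally a) -> filterlim g F (locally b) ->
  filterlim (fun t => f t / g t) F (locally (a / b)).
Proof. intros Hb Hf Hg. apply flim_mult; [exact Hf | apply flim_inv; assumption]. Qed.

Lemma flim_Rpower f (a b : R) :
  0 < a -> filterlim f F (locally a) ->
  filterlim (fun t => Rpower (f t) b) F (locally (Rpower a b)).
Proof.
  intros Ha Hf. apply (flim_continuous (fun y => Rpower y b)); [| exact Hf].
  apply (ex_derive_continuous (fun y => Rpower y b)).
  unfold Rpower; auto_derive; exact Ha.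
Qed.

Lemma flim_eps f (a : R) :
  (forall eps : posreal, F (fun t => Rabs (f t - a) < eps)) <->
  filterlim f F (locally a).
Proof. symmetry; exact (filterlim_locally f a). Qed.

Lemma flim_squeeze f g (a : R) :
  F (fun t => Rabs (f t - a) <= g t) -> filterlim g F (locally 0) ->
  filterlim f F (locally a).
Proof.
  intros Hle Hg. apply flim_eps; intros eps.
  generalize (filter_and _ _ Hle (proj2 (flim_eps g 0) Hg eps)).
  apply filter_imp; intros t [H1 H2].
  rewrite Rminus_0_r in H2. apply Rle_lt_trans with (2 := H2).
  apply Rle_trans with (1 := H1), Rle_abs.
Qed.

Lemma flim_ext f g (a : R) :
  F (fun t => f t = g t) -> filterlim f F (locally a) -> filterlim g F (locally a).
Proof. intros H; exact (filterlim_ext_loc f g H). Qed.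

Lemma flim_neq0 f (a : R) :
  a <> 0 -> filterlim f F (locally a) -> F (fun t => f t <> 0).
Proof.
  intros Ha Hf.
  generalize (proj2 (flim_eps f a) Hf (mkposreal _ (Rabs_pos_lt a Ha))); simpl.
  apply filter_imp. intros t Ht E. rewrite E, Rminus_0_l, Rabs_Ropp in Ht. lra.
Qed.

End FilterLimits.

Lemma exp_le a b : a <= b -> exp a <= exp b.
Proof. intros [H | ->]; [apply Rlt_le, exp_increasing, H | apply Rle_refl]. Qed.

Lemma pow_opp1_sqr k : (-1) ^ k * (-1) ^ k = 1.
Proof.
  rewrite <- Rpow_mult_distr. replace (-1 * -1) with 1 by ring. apply pow1.
Qed.

Lemma Rpower_div a b e : 0 < a -> 0 < b -> Rpower (a / b) e = Rpower a e / Rpower b e.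
Proof.
  intros Ha Hb. unfold Rdiv at 1.
  rewrite <- Rpower_mult_distr by (try apply Rinv_0_lt_compat; assumption).
  unfold Rdiv. f_equal.
  unfold Rpower. rewrite ln_Rinv, <- exp_Ropp by exact Hb. f_equal. ring.
Qed.

Lemma lim_inv_INR : is_lim_seq (fun k => / INR k) 0.
Proof. apply (is_lim_seq_inv INR p_infty); [apply is_lim_seq_INR | discriminate]. Qed.

Lemma lim_inv_S : is_lim_seq (fun k => / (INR k + 1)) 0.
Proof.
  apply (is_lim_seq_ext (fun k => / INR (S k))); [intros k; rewrite S_INR; reflexivity |].
  apply (is_lim_seq_incr_1 (fun k => / INR k)), lim_inv_INR.
Qed.

(** * Euler's product for the sine *)

Definition cos_moment (x : R) (m : nat) : R :=
  RInt (fun t => cos (2 * x * t) * cos t ^ m) 0 (PI / 2).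

Lemma ex_RInt_cos_moment x m a b :
  ex_RInt (fun t => cos (2 * x * t) * cos t ^ m) a b.
Proof.
  apply (ex_RInt_continuous (V := R_CompleteNormedModule)); intros t _.
  apply (ex_derive_continuous (fun t => cos (2 * x * t) * cos t ^ m)).
  auto_derive; exact I.
Qed.

Lemma cos_moment_0 x : x <> 0 -> cos_moment x 0 = sin (PI * x) / (2 * x).
Proof.
  intros Hx. unfold cos_moment. apply is_RInt_unique.
  replace (sin (PI * x) / (2 * x)) with
    (minus (sin (2 * x * (PI / 2)) / (2 * x)) (sin (2 * x * 0) / (2 * x))).
  - apply (is_RInt_derive (V := R_CompleteNormedModule) (fun t => sin (2 * x * t) / (2 * x))).
    + intros t _. auto_derive; [exact I |]. simpl; field; exact Hx.
    + intros t _. apply (ex_derive_continuous (fun t => cos (2 * x * t) * cos t ^ 0)).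
      auto_derive; exact I.
  - unfold minus, plus, opp; simpl. rewrite Rmult_0_r, sin_0.
    replace (2 * x * (PI / 2)) with (PI * x) by field. field; exact Hx.
Qed.

(** Two integrations by parts at once: with [m = k + 2], the difference of the two
    integrands is the derivative of
    [m cos (2xt) cos^(m-1) t sin t - 2x sin (2xt) cos^m t], which vanishes at both ends. *)
Lemma cos_moment_rec x k :
  ((INR k + 2) ^ 2 - (2 * x) ^ 2) * cos_moment x (k + 2)
  = (INR k + 2) * (INR k + 1) * cos_moment x k.
Proof.
  set (A := (INR k + 2) ^ 2 - (2 * x) ^ 2).
  set (B := (INR k + 2) * (INR k + 1)).
  assert (H1 := is_RInt_minus (V := R_NormedModule) _ _ _ _ _ _
    (is_RInt_scal (V := R_NormedModule) _ _ _ A _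
      (RInt_correct (V := R_CompleteNormedModule) _ _ _ (ex_RInt_cos_moment x (k + 2) 0 (PI / 2))))
    (is_RInt_scal (V := R_NormedModule) _ _ _ B _
      (RInt_correct (V := R_CompleteNormedModule) _ _ _ (ex_RInt_cos_moment x k 0 (PI / 2))))).
  apply Rminus_diag_uniq.
  apply (is_RInt_unique (V := R_CompleteNormedModule)) in H1.
  refine (eq_trans (eq_sym H1) _).
  apply is_RInt_unique.
  set (f := fun t => - (2 * x) * sin (2 * x * t) * cos t ^ (k + 2)
                     + (INR k + 2) * cos (2 * x * t) * (cos t ^ (k + 1) * sin t)).
  replace 0 with (minus (f (PI / 2)) (f 0)) at 2.
  - apply (is_RInt_derive (V := R_CompleteNormedModule) f).
    + intros t _. unfold f. auto_derive; [exact I |].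
      unfold minus, plus, opp, scal; simpl; unfold mult; simpl.
      rewrite !Nat.add_succ_r, !Nat.add_0_r. rewrite !S_INR. simpl.
      assert (Hs : sin t * sin t = 1 - cos t * cos t).
      { generalize (sin2_cos2 t); unfold Rsqr; lra. }
      unfold A, B. ring_simplify.
      replace (sin t ^ 2) with (1 - cos t * cos t) by (rewrite <- Hs; ring).
      ring.
    + intros t _.
      apply (ex_derive_continuous (fun t => minus (scal A (cos (2 * x * t) * cos t ^ (k + 2)))
                                               (scal B (cos (2 * x * t) * cos t ^ k)))).
      unfold minus, plus, opp, scal; simpl; unfold mult; simpl.
      auto_derive; exact I.
  - unfold f, minus, plus, opp; simpl. rewrite cos_PI2, Rmult_0_r, sin_0.
    rewrite !Nat.add_succ_r, !Nat.add_0_r. simpl. ring.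
Qed.

Lemma cos_pow_pos m t : 0 <= t <= PI / 2 -> 0 <= cos t ^ m.
Proof. intros [H0 H1]. apply pow_le, cos_ge_0; lra. Qed.

Lemma cos_moment_at_0_pos m : 0 < cos_moment 0 m.
Proof.
  assert (HPI := PI_RGT_0). unfold cos_moment.
  apply RInt_gt_0; [lra | |].
  - intros t Ht. rewrite Rmult_0_r, Rmult_0_l, cos_0, Rmult_1_l.
    apply pow_lt, cos_gt_0; lra.
  - intros t _. apply (ex_derive_continuous (fun t => cos (2 * 0 * t) * cos t ^ m)).
    auto_derive; exact I.
Qed.

Lemma Rabs_sin_le u : Rabs (sin u) <= Rabs u.
Proof.
  assert (Hpos : forall v, 0 <= v -> Rabs (sin v) <= v).
  { intros v Hv. destruct (Req_dec v 0) as [-> | Hn]; [rewrite sin_0, Rabs_R0; lra |].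
    assert (Hlt : sin v < v) by (apply sin_lt_x; lra).
    apply Rabs_le; split; [| lra].
    destruct (Rle_dec v PI) as [Hp | Hp].
    - generalize (sin_ge_0 v Hv Hp); lra.
    - generalize (SIN_bound v) PI2_1; lra. }
  destruct (Rle_dec 0 u) as [H | H].
  - rewrite (Rabs_pos_eq u) by exact H. apply Hpos, H.
  - rewrite (Rabs_left u), <- (Rabs_Ropp (sin u)), <- sin_neg by lra. apply Hpos; lra.
Qed.

Lemma mul_cos_le_sin t : 0 <= t <= PI / 2 -> t * cos t <= sin t.
Proof.
  intros Ht. set (h := fun t => sin t - t * cos t).
  assert (Hh : h 0 <= h t).
  { destruct (MVT_gen h 0 t (fun t => t * sin t)) as [c [Hc Hc']].
    - intros y _. unfold h. auto_derive; [exact I | ring].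
    - intros y _. apply continuity_pt_filterlim.
      apply (ex_derive_continuous h). unfold h; auto_derive; exact I.
    - rewrite Rmin_left, Rmax_right in Hc by lra.
      assert (0 <= sin c) by (apply sin_ge_0; lra).
      assert (0 <= c * sin c * (t - 0)) by (apply Rmult_le_pos; [apply Rmult_le_pos |]; lra).
      lra. }
  unfold h in Hh. rewrite sin_0 in Hh. lra.
Qed.

(** [1 - cos u <= u^2 / 2] and [t cos t <= sin t] bound the difference of the two
    integrands by [2 x^2 (cos^k t - cos^(k+2) t)], whose integral the recurrence
    evaluates. *)
Lemma cos_moment_close x k :
  Rabs (cos_moment x (k + 2) - cos_moment 0 (k + 2))
  <= 2 * x ^ 2 / (INR k + 1) * cos_moment 0 (k + 2).
Proof.
  assert (HPI := PI_RGT_0).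
  assert (Hk := pos_INR k).
  assert (Hsub : forall y, cos_moment y (k + 2) - cos_moment 0 (k + 2)
     = RInt (fun t => minus (cos (2 * y * t) * cos t ^ (k + 2)) (cos (2 * 0 * t) * cos t ^ (k + 2)))
            0 (PI / 2)).
  { intros y. rewrite (RInt_minus (V := R_CompleteNormedModule)); try apply ex_RInt_cos_moment.
    reflexivity. }
  rewrite Hsub.
  apply Rle_trans with (RInt (fun t => scal (2 * x ^ 2) (minus (cos (2 * 0 * t) * cos t ^ k)
        (cos (2 * 0 * t) * cos t ^ (k + 2)))) 0 (PI / 2)).
  - refine (norm_RInt_le (V := R_NormedModule) _ _ 0 (PI / 2) _ _ _ _ (RInt_correct (V := R_CompleteNormedModule) _ _ _ _) (RInt_correct (V := R_CompleteNormedModule) _ _ _ _)).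
    + lra.
    + intros t Ht. rewrite Rmult_0_r, Rmult_0_l, cos_0.
      unfold minus, plus, opp, scal, norm; simpl; unfold mult, abs; simpl.
      rewrite Nat.add_succ_r, Nat.add_succ_r, Nat.add_0_r; simpl.
      assert (Hc := cos_pow_pos k t Ht).
      assert (Hs2 := sin2_cos2 t). unfold Rsqr in Hs2.
      assert (Hcos : 0 <= cos t) by (apply cos_ge_0; lra).
      assert (Hsin : 0 <= sin t) by (apply sin_ge_0; lra).
      assert (Htc := mul_cos_le_sin t Ht).
      assert (Hcs : 0 <= 1 - cos (2 * x * t) <= 2 * x ^ 2 * t ^ 2).
      { replace (2 * x * t) with (2 * (x * t)) by ring.
        rewrite cos_2a_sin.
        assert (H := Rabs_sin_le (x * t)).
        apply Rsqr_le_abs_1 in H. unfold Rsqr in H.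
        assert (0 <= sin (x * t) * sin (x * t)) by nra. split; nra. }
      set (C := cos (2 * x * t)) in *. set (c := cos t) in *.
      replace (C * (c * (c * c ^ k)) + - (1 * (c * (c * c ^ k))))
        with (- ((1 - C) * (c * c) * c ^ k)) by ring.
      rewrite Rabs_Ropp, Rabs_pos_eq by (apply Rmult_le_pos; [apply Rmult_le_pos|]; nra).
      replace (2 * (x * (x * 1)) * (1 * c ^ k + - (1 * (c * (c * c ^ k)))))
        with (2 * x ^ 2 * (sin t * sin t) * c ^ k)
        by (replace (sin t * sin t) with (1 - c * c) by lra; ring).
      apply Rmult_le_compat_r; [exact Hc |].
      apply Rle_trans with (2 * x ^ 2 * t ^ 2 * (c * c)).
      * apply Rmult_le_compat_r; nra.
      * replace (2 * x ^ 2 * t ^ 2 * (c * c)) with (2 * x ^ 2 * ((t * c) * (t * c))) by ring.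
        apply Rmult_le_compat_l; [nra |].
        apply Rmult_le_compat; nra.
    + apply (ex_RInt_minus (V := R_NormedModule)); apply ex_RInt_cos_moment.
    + apply (ex_RInt_scal (V := R_NormedModule)), (ex_RInt_minus (V := R_NormedModule)); apply ex_RInt_cos_moment.
  - rewrite (RInt_scal (V := R_CompleteNormedModule)).
    2: apply (ex_RInt_minus (V := R_NormedModule)); apply ex_RInt_cos_moment.
    rewrite (RInt_minus (V := R_CompleteNormedModule)); try apply ex_RInt_cos_moment.
    fold (cos_moment 0 k) (cos_moment 0 (k + 2)).
    unfold minus, plus, opp, scal; simpl; unfold mult; simpl.
    assert (Hrec := cos_moment_rec 0 k).
    assert (Hkk : cos_moment 0 k = (INR k + 2) / (INR k + 1) * cos_moment 0 (k + 2)).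
    { apply (Rmult_eq_reg_l ((INR k + 2) * (INR k + 1))); [| nra].
      rewrite <- Hrec. field; lra. }
    rewrite Hkk. apply Req_le. field; lra.
Qed.

(** The left-hand side is [x (1 - x^2/1^2) ... (1 - x^2/k^2)]: by the recurrence it
    is a constant multiple of the ratio of two cosine moments, which tends to [1]. *)
Lemma euler_sine_product x :
  x <> 0 ->
  is_lim_seq (fun k => (INR k + 1) * gbinom x (S k) * gbinom (- x - 1) k) (sin (PI * x) / PI).
Proof.
  intros Hx.
  set (P := fun k => (INR k + 1) * gbinom x (S k) * gbinom (- x - 1) k).
  assert (HPI := PI_RGT_0).
  assert (HI0 : cos_moment 0 0 = PI / 2).
  { unfold cos_moment. rewrite (RInt_ext _ (fun _ => 1)).
    - rewrite RInt_const. unfold scal; simpl; unfold mult; simpl. lra.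
    - intros t _. rewrite Rmult_0_r, Rmult_0_l, cos_0. simpl; ring. }
  assert (HPrec : forall k, P (S k) = P k * (1 - x ^ 2 / (INR k + 1) ^ 2)).
  { intros k. unfold P, gbinom.
    rewrite (fact_simpl (S k)), (fact_simpl k), !mult_INR. cbn [falling]. rewrite !S_INR.
    assert (Hk := pos_INR k). assert (Hf := INR_fact_lt_0 k).
    field. repeat split; lra. }
  assert (Hinv : forall k, P k * cos_moment x (2 * k) = cos_moment 0 (2 * k) * (sin (PI * x) / PI)).
  { induction k as [| k IH].
    - unfold P, gbinom; simpl. rewrite cos_moment_0 by exact Hx. rewrite HI0. field. lra.
    - replace (2 * S k)%nat with (2 * k + 2)%nat by lia.
      assert (Hk := pos_INR k).
      assert (E1 := cos_moment_rec x (2 * k)). assert (E0 := cos_moment_rec 0 (2 * k)).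
      rewrite mult_INR in E1, E0. simpl (INR 2) in E1, E0.
      rewrite HPrec.
      apply (Rmult_eq_reg_l ((2 * INR k + 2) ^ 2)); [| nra].
      transitivity (P k * (((1 + 1) * INR k + 2) ^ 2 - (2 * x) ^ 2) * cos_moment x (2 * k + 2)).
      { field; lra. }
      rewrite Rmult_assoc, E1.
      transitivity ((((1 + 1) * INR k + 2) ^ 2 - (2 * 0) ^ 2) * cos_moment 0 (2 * k + 2) * (sin (PI * x) / PI));
        [| field; lra].
      rewrite E0. 
      transitivity (((1 + 1) * INR k + 2) * ((1 + 1) * INR k + 1) * (P k * cos_moment x (2 * k))); [ring |].
      rewrite IH; ring. }
  assert (Hratio : is_lim_seq (fun k => cos_moment x (2 * S k) / cos_moment 0 (2 * S k)) 1).
  { apply (flim_squeeze _ (fun k => 2 * x ^ 2 * / (INR k + 1))).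
    - apply filter_forall; intros k.
      replace (2 * S k)%nat with (2 * k + 2)%nat by lia.
      assert (Hpos := cos_moment_at_0_pos (2 * k + 2)).
      assert (Hc := cos_moment_close x (2 * k)). assert (Hk := pos_INR k).
      replace (cos_moment x (2 * k + 2) / cos_moment 0 (2 * k + 2) - 1)
        with ((cos_moment x (2 * k + 2) - cos_moment 0 (2 * k + 2)) / cos_moment 0 (2 * k + 2))
        by (field; lra).
      unfold Rdiv; rewrite Rabs_mult, Rabs_inv, (Rabs_pos_eq (cos_moment 0 _)) by lra.
      apply Rle_trans with (2 * x ^ 2 / (INR (2 * k) + 1)).
      + apply (Rmult_le_reg_r (cos_moment 0 (2 * k + 2))); [exact Hpos |].
        rewrite Rmult_assoc, Rinv_l by lra. lra.
      + apply Rmult_le_compat_l; [nra |]. apply Rinv_le_contravar; [lra |].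
        rewrite mult_INR; simpl (INR 2); lra.
    - replace 0 with (2 * x ^ 2 * 0) by ring.
      apply flim_mult; [apply filterlim_const | apply lim_inv_S]. }
  apply is_lim_seq_incr_1.
  apply (flim_ext (fun k => sin (PI * x) / PI / (cos_moment x (2 * S k) / cos_moment 0 (2 * S k)))).
  - assert (Hev : eventually (fun k => Rabs (cos_moment x (2 * S k) / cos_moment 0 (2 * S k) - 1) < 1)).
    { exact (proj2 (flim_eps _ 1) Hratio (mkposreal 1 Rlt_0_1)). }
    revert Hev; apply filter_imp; intros k Hk.
    assert (Hpos := cos_moment_at_0_pos (2 * S k)).
    assert (Hnz : cos_moment x (2 * S k) <> 0).
    { intros E. rewrite E in Hk. unfold Rdiv in Hk. rewrite Rmult_0_l, Rminus_0_l, Rabs_Ropp, Rabs_R1 in Hk. lra. }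
    change (sin (PI * x) / PI / (cos_moment x (2 * S k) / cos_moment 0 (2 * S k)) = P (S k)).
    apply (Rmult_eq_reg_r (cos_moment x (2 * S k))); [| exact Hnz].
    rewrite Hinv. field. repeat split; lra.
  - assert (H := flim_div _ _ _ 1 R1_neq_R0 (filterlim_const (sin (PI * x) / PI)) Hratio).
    rewrite Rdiv_1_r in H. exact H.
Qed.

(** * The Gamma function and its product limit *)

Definition gamma_density (y t : R) : R := Rpower t y * exp (- t).

Local Notation is_RInt_pos f l := (is_RInt_gen f (at_right 0) (Rbar_locally p_infty) l).

Lemma positive_interval (P : R * R -> Prop) :
  (forall a b, 0 < a < b -> P (a, b)) ->
  filter_prod (at_right 0) (Rbar_locally p_infty) P.
Proof.
  intros H. apply (Filter_prod _ _ _ (fun a => 0 < a < 1) (fun b => 1 < b)).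
  - exists (mkposreal 1 Rlt_0_1). intros a Ha Ha0. split; [exact Ha0 |].
    unfold ball in Ha; simpl in Ha; unfold AbsRing_ball, minus, plus, opp, abs in Ha; simpl in Ha.
    apply Rabs_def2 in Ha; lra.
  - exists 1. intros b Hb; exact Hb.
  - intros a b Ha Hb. apply H; lra.
Qed.

Lemma ex_RInt_positive (f : R -> R) a b :
  (forall t, 0 < t -> continuous f t) -> 0 < a -> 0 < b -> ex_RInt f a b.
Proof.
  intros Hf Ha Hb. apply (ex_RInt_continuous (V := R_CompleteNormedModule)).
  intros t Ht. apply Hf. generalize (Rmin_glb_lt _ _ _ Ha Hb); lra.
Qed.

Lemma RInt_dominated (f g : R -> R) a b :
  (forall t, 0 < t -> continuous f t) -> (forall t, 0 < t -> continuous g t) ->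
  (forall t, 0 < t -> Rabs (f t) <= g t) -> 0 < a -> 0 < b ->
  Rabs (RInt f a b) <= Rabs (RInt g a b).
Proof.
  intros Hf Hg Hfg.
  assert (Hle : forall a b, 0 < a -> a <= b -> Rabs (RInt f a b) <= Rabs (RInt g a b)).
  { intros c d Hc Hcd. apply Rle_trans with (2 := Rle_abs _).
    refine (norm_RInt_le (V := R_NormedModule) f g c d _ _ Hcd _
      (RInt_correct (V := R_CompleteNormedModule) _ _ _ _)
      (RInt_correct (V := R_CompleteNormedModule) _ _ _ _)).
    - intros t Ht. apply Hfg; lra.
    - apply ex_RInt_positive; [exact Hf | lra | lra].
    - apply ex_RInt_positive; [exact Hg | lra | lra]. }
  intros Ha Hb. destruct (Rle_dec a b) as [H | H]; [apply Hle; lra |].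
  rewrite <- (opp_RInt_swap f), <- (opp_RInt_swap g); try (apply ex_RInt_positive; assumption).
  unfold opp; simpl. rewrite !Rabs_Ropp. apply Hle; lra.
Qed.

(** Cauchy's criterion: moving either endpoint changes the integral of [f] by at most
    the change in the integral of [g]. *)
Lemma ex_RInt_pos_dominated (f g : R -> R) l :
  (forall t, 0 < t -> continuous f t) -> (forall t, 0 < t -> continuous g t) ->
  (forall t, 0 < t -> Rabs (f t) <= g t) -> is_RInt_pos g l ->
  exists m : R, is_RInt_pos f m.
Proof.
  intros Hf Hg Hfg Hl.
  assert (Hex : forall h, (forall t, 0 < t -> continuous h t) ->
    filter_prod (at_right 0) (Rbar_locally p_infty) (fun ab : R * R =>
      (exists y : R, is_RInt h (fst ab) (snd ab) y) /\
      (forall y1 y2 : R, is_RInt h (fst ab) (snd ab) y1 -> is_RInt h (fst ab) (snd ab) y2 -> y1 = y2))).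
  { intros h Hh. apply positive_interval; intros a b Hab; simpl. split.
    - apply ex_RInt_positive; [exact Hh | lra | lra].
    - intros y1 y2 H1 H2. rewrite <- (is_RInt_unique _ _ _ _ H1). apply is_RInt_unique, H2. }
  apply (proj1 (filterlimi_locally_cauchy (U := R_CompleteSpace) _ (Hex f Hf))).
  intros eps.
  destruct (proj2 (filterlimi_locally_cauchy (U := R_CompleteSpace) _ (Hex g Hg))
              (ex_intro _ l Hl) (pos_div_2 eps)) as [P [[Q S HQ HS HP] Hc]].
  exists (fun ab => (Q (fst ab) /\ S (snd ab)) /\ 0 < fst ab < snd ab). split.
  { apply filter_and.
    - exact (Filter_prod _ _ _ Q S HQ HS (fun a b Ha Hb => conj Ha Hb)).
    - apply positive_interval; intros a b Hab; exact Hab. }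
  intros [a b] [a' b'] [[Qa Sb] Hab] [[Qa' Sb'] Hab'] u v Hu Hv; simpl in *.
  assert (Eg : forall c d, 0 < c -> 0 < d -> is_RInt g c d (RInt g c d)).
  { intros c d Hc0 Hd0. apply (RInt_correct (V := R_CompleteNormedModule)), ex_RInt_positive; assumption. }
  assert (Hsmall : forall c d c' d', Q c -> S d -> Q c' -> S d' -> 0 < c -> 0 < d -> 0 < c' -> 0 < d' ->
            Rabs (RInt g c' d' - RInt g c d) < eps / 2).
  { intros c d c' d' Qc Sd Qc' Sd' c0 d0 c0' d0'.
    apply (Hc (c, d) (c', d') (HP c d Qc Sd) (HP c' d' Qc' Sd')); apply Eg; assumption. }
  assert (Hch : forall (h : R -> R) c d e, (forall t, 0 < t -> continuous h t) -> 0 < c -> 0 < d -> 0 < e ->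
            RInt h c d + RInt h d e = RInt h c e :> R).
  { intros h c d e Hh c0 d0 e0.
    apply (RInt_Chasles (V := R_CompleteNormedModule)); apply ex_RInt_positive; assumption. }
  rewrite <- (is_RInt_unique _ _ _ _ Hu), <- (is_RInt_unique _ _ _ _ Hv).
  change (Rabs (RInt f a' b' - RInt f a b) < eps).
  assert (E : RInt f a' b' - RInt f a b = RInt f a' a + RInt f b b' :> R).
  { rewrite <- (Hch f a' a b'), <- (Hch f a b b') by (try exact Hf; lra).
    ring. }
  rewrite E. apply Rle_lt_trans with (1 := Rabs_triang _ _).
  assert (D1 := RInt_dominated f g a' a Hf Hg Hfg ltac:(lra) ltac:(lra)).
  assert (D2 := RInt_dominated f g b b' Hf Hg Hfg ltac:(lra) ltac:(lra)).
  assert (S1 := Hsmall a b a' b Qa Sb Qa' Sb ltac:(lra) ltac:(lra) ltac:(lra) ltac:(lra)).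
  assert (S2 := Hsmall a b a b' Qa Sb Qa Sb' ltac:(lra) ltac:(lra) ltac:(lra) ltac:(lra)).
  rewrite <- (Hch g a' a b) in S1 by (try exact Hg; lra).
  rewrite <- (Hch g a b b') in S2 by (try exact Hg; lra).
  rewrite Rplus_minus_r in S1.
  rewrite Rplus_minus_l in S2.
  lra.
Qed.

Lemma is_RInt_pos_ext (f g : R -> R) (l : R) :
  (forall t, 0 < t -> f t = g t) -> is_RInt_pos f l -> is_RInt_pos g l.
Proof.
  intros H. apply (is_RInt_gen_ext (V := R_NormedModule)).
  apply positive_interval; intros a b Hab t Ht; simpl in Ht.
  apply H. rewrite Rmin_left in Ht; lra.
Qed.

Lemma is_RInt_pos_primitive (f df : R -> R) (la lb : R) :
  (forall t, 0 < t -> is_derive f t (df t)) -> (forall t, 0 < t -> continuous df t) ->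
  filterlim f (at_right 0) (locally la) -> filterlim f (Rbar_locally p_infty) (locally lb) ->
  is_RInt_pos df (lb - la).
Proof.
  intros Hd Hc Ha Hb.
  apply (is_RInt_pos_ext (Derive f)); [intros t Ht; apply is_derive_unique, Hd, Ht |].
  apply is_RInt_gen_Derive; try assumption.
  - apply positive_interval; intros a b Hab t Ht; simpl in Ht.
    rewrite Rmin_left in Ht by lra. exists (df t). apply Hd; lra.
  - apply positive_interval; intros a b Hab t Ht; simpl in Ht.
    rewrite Rmin_left in Ht by lra.
    apply (continuous_ext_loc _ df); [| apply Hc; lra].
    apply (locally_interval _ t 0 p_infty); simpl; [lra | exact I |].
    intros y Hy _. symmetry. apply is_derive_unique, Hd, Hy.
Qed.

Lemma is_RInt_pos_le (f g : R -> R) (lf lg : R) :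
  (forall t, 0 < t -> 0 <= f t <= g t) -> is_RInt_pos f lf -> is_RInt_pos g lg -> lf <= lg.
Proof.
  intros H Hf Hg.
  apply Rle_trans with (1 := Rle_abs lf).
  refine (RInt_gen_norm (V := R_CompleteNormedModule) f g lf lg _ _ Hf Hg).
  - apply positive_interval; simpl; intros; lra.
  - apply positive_interval; simpl; intros a b Hab t Ht.
    unfold norm; simpl. unfold abs; simpl. rewrite Rabs_pos_eq; apply H; lra.
Qed.

Lemma gamma_density_pos y t : 0 < gamma_density y t.
Proof. apply Rmult_lt_0_compat; apply exp_pos. Qed.

Lemma continuous_gamma_density y t : 0 < t -> continuous (gamma_density y) t.
Proof.
  intros Ht. apply (ex_derive_continuous (gamma_density y)).
  unfold gamma_density, Rpower. auto_derive; exact Ht.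
Qed.

Lemma gamma_density_succ y t : 0 < t -> gamma_density (y + 1) t = t * gamma_density y t.
Proof. intros Ht. unfold gamma_density. rewrite Rpower_plus, Rpower_1 by exact Ht. ring. Qed.

Lemma gamma_density_lim_0 y : 0 < y -> filterlim (gamma_density y) (at_right 0) (locally 0).
Proof.
  intros Hy.
  replace 0 with (0 * exp (- 0)) at 2 by ring.
  unfold gamma_density. apply flim_mult.
  - unfold Rpower.
    apply (filterlim_comp _ _ _ (fun t => y * ln t) exp _ (Rbar_locally m_infty)); [| exact is_lim_exp_m].
    apply (filterlim_comp _ _ _ ln (Rmult y) _ (Rbar_locally m_infty)); [exact is_lim_ln_0 |].
    intros P [M HM]. exists (M / y). intros t Ht. apply HM.
    apply (Rmult_lt_compat_l y) in Ht; [| exact Hy].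
    replace (y * (M / y)) with M in Ht by (field; lra). exact Ht.
  - apply (filterlim_filter_le_1 (F := locally 0)); [apply filter_le_within |].
    apply (ex_derive_continuous (fun t => exp (- t))). auto_derive; exact I.
Qed.

(** [ln u <= u - 1] at [u = t / (2 y)] leaves half of the exponential decay. *)
Lemma gamma_density_le_exp y t :
  0 < y -> 0 < t -> gamma_density y t <= exp (y * ln (2 * y)) * exp (- (t / 2)).
Proof.
  intros Hy Ht. unfold gamma_density, Rpower. rewrite <- 2!exp_plus.
  apply exp_le. 
  assert (H := exp_ineq1_le (ln (t / (2 * y)))).
  rewrite exp_ln in H by (apply Rdiv_lt_0_compat; lra).
  rewrite ln_div in H by lra.
  apply (Rmult_le_compat_l y) in H; [| lra].
  replace (y * (t / (2 * y))) with (t / 2) in H by (field; lra). lra.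
Qed.

Lemma exp_opp_lim (c : R) : 0 < c ->
  filterlim (fun t => exp (- (t / c))) (Rbar_locally p_infty) (locally 0).
Proof.
  intros Hc.
  apply (filterlim_comp _ _ _ (fun t => - (t / c)) exp _ (Rbar_locally m_infty)); [| exact is_lim_exp_m].
  intros P [M HM]. exists (- M * c). intros t Ht. apply HM.
  assert (H : - M < t / c).
  { apply (Rmult_lt_reg_r c); [exact Hc |]. unfold Rdiv. rewrite Rmult_assoc, Rinv_l; lra. }
  lra.
Qed.

Lemma gamma_density_lim_infty y :
  0 < y -> filterlim (gamma_density y) (Rbar_locally p_infty) (locally 0).
Proof.
  intros Hy.
  apply (flim_squeeze _ (fun t => exp (y * ln (2 * y)) * exp (- (t / 2)))).
  - exists 0. intros t Ht. rewrite Rminus_0_r, Rabs_pos_eq by (apply Rlt_le, gamma_density_pos).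
    apply gamma_density_le_exp; lra.
  - replace 0 with (exp (y * ln (2 * y)) * 0) by ring.
    apply flim_mult; [apply filterlim_const | apply exp_opp_lim; lra].
Qed.

Lemma is_RInt_gamma_density_0 : is_RInt_pos (gamma_density 0) 1.
Proof.
  apply (is_RInt_pos_ext (fun t => exp (- t))).
  { intros t Ht. unfold gamma_density. rewrite Rpower_O by exact Ht. ring. }
  replace 1 with (- 0 - - exp (- 0)) by (rewrite Ropp_0, exp_0; ring).
  apply (is_RInt_pos_primitive (fun t => - exp (- t))).
  - intros t _. auto_derive; [exact I | ring].
  - intros t _. apply (ex_derive_continuous (fun t => exp (- t))). auto_derive; exact I.
  - apply (filterlim_filter_le_1 (F := locally 0)); [apply filter_le_within |].
    apply (ex_derive_continuous (fun t => - exp (- t))). auto_derive; exact I.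
  - apply flim_opp. apply (filterlim_ext (fun t => exp (- (t / 1)))).
    + intros t. rewrite Rdiv_1_r. reflexivity.
    + apply exp_opp_lim; lra.
Qed.

(** The integrand is the derivative of [t^(y+1) exp (-t)], which vanishes at both ends. *)
Lemma is_RInt_gamma_by_parts y :
  0 <= y -> is_RInt_pos (fun t => (y + 1) * gamma_density y t - gamma_density (y + 1) t) 0.
Proof.
  intros Hy. replace 0 with (0 - 0) at 2 by ring.
  apply (is_RInt_pos_primitive (gamma_density (y + 1))).
  - intros t Ht. rewrite gamma_density_succ by exact Ht.
    unfold gamma_density, Rpower. auto_derive; [exact Ht |].
    replace ((y + 1) * ln t) with (y * ln t + ln t) by ring.
    rewrite exp_plus, exp_ln by exact Ht. field; lra.
  - intros t Ht.
    apply (ex_derive_continuous (fun t => (y + 1) * gamma_density y t - gamma_density (y + 1) t)).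
    unfold gamma_density, Rpower. auto_derive; repeat split; exact Ht.
  - apply gamma_density_lim_0; lra.
  - apply gamma_density_lim_infty; lra.
Qed.

Lemma is_RInt_gamma_succ y l :
  0 <= y -> is_RInt_pos (gamma_density y) l -> is_RInt_pos (gamma_density (y + 1)) ((y + 1) * l).
Proof.
  intros Hy Hl.
  assert (H := is_RInt_gen_minus (V := R_NormedModule) _ _ _ _
                 (is_RInt_gen_scal (V := R_NormedModule) _ (y + 1) _ Hl) (is_RInt_gamma_by_parts y Hy)).
  revert H. unfold minus, plus, opp, scal; simpl; unfold mult; simpl.
  rewrite Ropp_0, Rplus_0_r.
  apply is_RInt_pos_ext. intros t _. ring.
Qed.

(** Concavity of [t^s]: the right-hand side is the tangent line at [a]. *)
Lemma Rpower_tangent s a t :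
  0 <= s <= 1 -> 0 < a -> 0 < t ->
  Rpower t s <= Rpower a s * (1 - s + s * (t / a)).
Proof.
  intros Hs Ha Ht.
  assert (Hu : 0 < t / a) by (apply Rdiv_lt_0_compat; lra).
  set (A := 1 - s + s * (t / a)).
  assert (HA : 0 < A).
  { unfold A. destruct (Req_dec s 0) as [-> | Hn]; [lra |].
    assert (0 < s * (t / a)) by (apply Rmult_lt_0_compat; lra). lra. }
  rewrite <- (exp_ln A HA) at 1. unfold Rpower. rewrite <- exp_plus. apply exp_le.
  assert (H1 := exp_ineq1_le (ln (/ A))). assert (H2 := exp_ineq1_le (ln (t / a / A))).
  rewrite exp_ln in H1 by (apply Rinv_0_lt_compat, HA).
  rewrite exp_ln in H2 by (apply Rdiv_lt_0_compat; assumption).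
  rewrite ln_Rinv in H1 by exact HA.
  rewrite !ln_div in H2 by assumption.
  apply (Rmult_le_compat_l (1 - s)) in H1; [| lra].
  apply (Rmult_le_compat_l s) in H2; [| lra].
  assert (E : (1 - s) * / A + s * (t / a / A) = 1).
  { transitivity (A / A); [| field; lra]. unfold A at 3. field. split; lra. }
  nra.
Qed.

(** For an exponent in [[0, 1]] the density is dominated by [(1 + t) exp (-t)], because
    [t^s <= 1 + t]; the recurrence reaches the other exponents. *)
Lemma ex_RInt_gamma y : 0 <= y -> exists l : R, is_RInt_pos (gamma_density y) l.
Proof.
  assert (Hbase : forall s, 0 <= s <= 1 -> exists l : R, is_RInt_pos (gamma_density s) l).
  { intros s Hs.
    assert (H0 := is_RInt_gamma_density_0).
    assert (H1 := is_RInt_gamma_succ 0 1 (Rle_refl 0) H0).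
    refine (ex_RInt_pos_dominated _ (fun t => gamma_density 0 t + gamma_density (0 + 1) t) _
              _ _ _ (is_RInt_gen_plus (V := R_NormedModule) _ _ _ _ H0 H1)).
    - intros t; apply continuous_gamma_density.
    - intros t Ht. apply (continuous_plus (V := R_NormedModule)); apply continuous_gamma_density, Ht.
    - intros t Ht. rewrite Rabs_pos_eq by (apply Rlt_le, gamma_density_pos).
      rewrite gamma_density_succ by exact Ht. unfold gamma_density.
      rewrite Rpower_O by exact Ht.
      assert (H := Rpower_tangent s 1 t Hs Rlt_0_1 Ht).
      unfold Rpower at 2 in H. rewrite ln_1, Rmult_0_r, exp_0, Rdiv_1_r in H.
      assert (He := exp_pos (- t)).
      replace (1 * exp (- t) + t * (1 * exp (- t))) with ((1 + t) * exp (- t)) by ring.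
      apply Rmult_le_compat_r; nra. }
  assert (Hind : forall k s, 0 <= s <= 1 -> exists l : R, is_RInt_pos (gamma_density (s + INR k)) l).
  { induction k as [| k IH]; intros s Hs.
    - simpl. rewrite Rplus_0_r. apply Hbase, Hs.
    - destruct (IH s Hs) as [l Hl]. exists ((s + INR k + 1) * l).
      rewrite S_INR, <- Rplus_assoc. apply is_RInt_gamma_succ; [| exact Hl].
      generalize (pos_INR k); lra. }
  intros Hy. destruct (nfloor_ex y Hy) as [k Hk].
  destruct (Hind k (y - INR k) ltac:(lra)) as [l Hl]. exists l.
  replace y with (y - INR k + INR k) by ring. exact Hl.
Qed.

Lemma Gamma_correct y : 0 <= y -> is_RInt_pos (gamma_density y) (Gamma (y + 1)).
Proof.
  intros Hy. destruct (ex_RInt_gamma y Hy) as [l Hl].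
  replace (Gamma (y + 1)) with l; [exact Hl |].
  symmetry. unfold Gamma. replace (y + 1 - 1) with y by ring.
  apply (is_RInt_gen_unique (V := R_CompleteNormedModule)). exact Hl.
Qed.

Lemma Gamma_unique y l : 0 <= y -> is_RInt_pos (gamma_density y) l -> Gamma (y + 1) = l.
Proof.
  intros Hy Hl. rewrite <- (is_RInt_gen_unique (V := R_CompleteNormedModule) _ _ (Gamma_correct y Hy)).
  apply (is_RInt_gen_unique (V := R_CompleteNormedModule)). exact Hl.
Qed.

Lemma Gamma_succ y : 0 <= y -> Gamma (y + 1 + 1) = (y + 1) * Gamma (y + 1).
Proof.
  intros Hy. apply Gamma_unique; [lra |]. apply is_RInt_gamma_succ; [exact Hy |].
  apply Gamma_correct, Hy.
Qed.

Lemma Gamma_fact k : Gamma (INR k + 1) = INR (fact k).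
Proof.
  induction k as [| k IH].
  - apply Gamma_unique; [apply Rle_refl | exact is_RInt_gamma_density_0].
  - rewrite S_INR, Gamma_succ by apply pos_INR. rewrite IH, fact_simpl, mult_INR, S_INR. reflexivity.
Qed.

(** Integrating the tangent line of [t^s] at [a = y + 1], the mean of the density
    [t^y exp (-t)]. *)
Lemma Gamma_interpolation y s :
  0 <= y -> 0 <= s <= 1 -> Gamma (y + s + 1) <= Rpower (y + 1) s * Gamma (y + 1).
Proof.
  intros Hy Hs.
  assert (H0 := Gamma_correct y Hy).
  assert (H1 := is_RInt_gamma_succ y _ Hy H0).
  assert (H := is_RInt_gen_scal (V := R_NormedModule) _ (Rpower (y + 1) s) _
     (is_RInt_gen_plus (V := R_NormedModule) _ _ _ _
       (is_RInt_gen_scal (V := R_NormedModule) _ (1 - s) _ H0)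
       (is_RInt_gen_scal (V := R_NormedModule) _ (s / (y + 1)) _ H1))).
  replace (Rpower (y + 1) s * Gamma (y + 1))
    with (scal (Rpower (y + 1) s) (plus (scal (1 - s) (Gamma (y + 1)))
            (scal (s / (y + 1)) ((y + 1) * Gamma (y + 1))))).
  2: { unfold plus, scal; simpl; unfold mult; simpl. field. lra. }
  refine (is_RInt_pos_le (gamma_density (y + s)) _ _ _ _ (Gamma_correct (y + s) ltac:(lra)) H).
  intros t Ht. split; [apply Rlt_le, gamma_density_pos |].
  unfold plus, scal; simpl; unfold mult; simpl.
  rewrite gamma_density_succ by exact Ht. unfold gamma_density. rewrite Rpower_plus.
  assert (HT := Rpower_tangent s (y + 1) t Hs ltac:(lra) Ht).
  assert (Hd := gamma_density_pos y t). unfold gamma_density in Hd.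
  apply (Rmult_le_compat_r _ _ _ (Rlt_le _ _ Hd)) in HT.
  replace (Rpower t y * Rpower t s * exp (- t)) with (Rpower t s * (Rpower t y * exp (- t))) by ring.
  apply Rle_trans with (1 := HT). apply Req_le. field. lra.
Qed.

(** Two interpolations, from [M] up to [M + s] and from [M + s] up to [M + 1],
    pin the Gamma function between powers of [M]. *)
Lemma Gamma_shift_asymptotic_unit s :
  0 <= s <= 1 ->
  is_lim_seq (fun M => Gamma (INR M + s + 1) / (INR (fact M) * Rpower (INR M) s)) 1.
Proof.
  intros Hs.
  apply (is_lim_seq_le_le_loc (fun M => 1 - / (INR (S M) + 1)) _ (fun M => 1 + / INR M)).
  - exists 1%nat. intros M HM.
    assert (HM1 : 1 <= INR M) by (apply (le_INR 1), HM).
    assert (HF := INR_fact_lt_0 M).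
    assert (Hp : forall a b, 0 < Rpower a b) by (intros; apply exp_pos).
    rewrite S_INR. split.
    + assert (H := Gamma_interpolation (INR M + s) (1 - s) ltac:(lra) ltac:(lra)).
      replace (INR M + s + (1 - s) + 1) with (INR (S M) + 1) in H by (rewrite S_INR; ring).
      rewrite Gamma_fact, fact_simpl, mult_INR, S_INR in H.
      assert (Hle : Rpower (INR M) s * Rpower (INR M + s + 1) (1 - s) <= INR M + 2).
      { apply Rle_trans with (Rpower (INR M + 2) s * Rpower (INR M + 2) (1 - s)).
        - apply Rmult_le_compat; try (apply Rlt_le, Hp); apply Rle_Rpower_l; lra.
        - rewrite <- Rpower_plus. replace (s + (1 - s)) with 1 by ring.
          rewrite Rpower_1; lra. }
      set (G := Gamma (INR M + s + 1)) in *.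
      set (A := Rpower (INR M) s) in *. set (B := Rpower (INR M + s + 1) (1 - s)) in *.
      assert (HA : 0 < A) by apply Hp. assert (HB : 0 < B) by apply Hp.
      assert (HG : 0 < G).
      { apply (Rmult_lt_reg_l B); [exact HB |]. rewrite Rmult_0_r.
        apply Rlt_le_trans with (2 := H). apply Rmult_lt_0_compat; lra. }
      apply (Rmult_le_reg_r (INR (fact M) * A)); [apply Rmult_lt_0_compat; lra |].
      replace (G / (INR (fact M) * A) * (INR (fact M) * A)) with G by (field; split; lra).
      apply (Rmult_le_reg_l (INR M + 2)); [lra |].
      replace ((INR M + 2) * ((1 - / (INR M + 1 + 1)) * (INR (fact M) * A)))
        with (A * ((INR M + 1) * INR (fact M))) by (field; lra).
      apply Rle_trans with (A * (B * G)); [apply Rmult_le_compat_l; lra |].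
      rewrite <- Rmult_assoc. apply Rmult_le_compat_r; lra.
    + assert (H := Gamma_interpolation (INR M) s ltac:(lra) Hs). rewrite Gamma_fact in H.
      assert (Hle : Rpower (INR M + 1) s <= (1 + / INR M) * Rpower (INR M) s).
      { replace (INR M + 1) with ((1 + / INR M) * INR M) by (field; lra).
        assert (0 < / INR M) by (apply Rinv_0_lt_compat; lra).
        rewrite <- Rpower_mult_distr by lra.
        apply Rmult_le_compat_r; [apply Rlt_le, Hp |].
        rewrite <- (Rpower_1 (1 + / INR M)) at 2 by lra. apply Rle_Rpower; lra. }
      set (A := Rpower (INR M) s) in *. assert (HA : 0 < A) by apply Hp.
      apply (Rmult_le_reg_r (INR (fact M) * A)); [apply Rmult_lt_0_compat; lra |].
      replace (Gamma (INR M + s + 1) / (INR (fact M) * A) * (INR (fact M) * A))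
        with (Gamma (INR M + s + 1)) by (field; split; lra).
      apply Rle_trans with (1 := H). 
      replace ((1 + / INR M) * (INR (fact M) * A)) with (((1 + / INR M) * A) * INR (fact M)) by ring.
      apply Rmult_le_compat_r; lra.
  - assert (H : is_lim_seq (fun M => 1 - / (INR (S M) + 1)) (1 - 0)).
    { apply (flim_minus (fun _ => 1)); [apply filterlim_const |].
      exact (proj1 (is_lim_seq_incr_1 (fun k => / (INR k + 1)) 0) lim_inv_S). }
    rewrite Rminus_0_r in H. exact H.
  - assert (H : is_lim_seq (fun M => 1 + / INR M) (1 + 0)).
    { apply (flim_plus (fun _ => 1)); [apply filterlim_const |].
      exact lim_inv_INR. }
    rewrite Rplus_0_r in H. exact H.
Qed.

Lemma Gamma_shift_asymptotic x :
  0 <= x ->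
  is_lim_seq (fun M => Gamma (INR M + x + 1) / (INR (fact M) * Rpower (INR M) x)) 1.
Proof.
  assert (Hind : forall k s, 0 <= s <= 1 ->
    is_lim_seq (fun M => Gamma (INR M + (s + INR k) + 1) / (INR (fact M) * Rpower (INR M) (s + INR k))) 1).
  { induction k as [| k IH]; intros s Hs.
    - simpl. rewrite Rplus_0_r. apply Gamma_shift_asymptotic_unit, Hs.
    - assert (Hk := pos_INR k).
      assert (H : is_lim_seq (fun M => (1 + (s + INR k + 1) * / INR M)
         * (Gamma (INR M + (s + INR k) + 1) / (INR (fact M) * Rpower (INR M) (s + INR k))))
         ((1 + (s + INR k + 1) * 0) * 1)).
      { apply flim_mult; [| exact (IH s Hs)].
        apply (flim_plus (fun _ => 1)); [apply filterlim_const |].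
        apply (flim_mult (fun _ => s + INR k + 1)); [apply filterlim_const |].
        exact lim_inv_INR. }
      rewrite Rmult_0_r, Rplus_0_r, Rmult_1_r in H.
      revert H. apply (is_lim_seq_ext_loc _ _ 1). exists 1%nat. intros M HM.
      assert (HM1 : 1 <= INR M) by (apply (le_INR 1), HM).
      rewrite S_INR. replace (INR M + (s + (INR k + 1)) + 1) with (INR M + (s + INR k) + 1 + 1) by ring.
      rewrite Gamma_succ by lra.
      replace (s + (INR k + 1)) with (s + INR k + 1) by ring.
      rewrite (Rpower_plus (s + INR k) 1), Rpower_1 by lra.
      field. repeat split; try lra; [apply Rgt_not_eq, exp_pos | apply INR_fact_neq_0]. }
  intros Hx. destruct (nfloor_ex x Hx) as [k Hk].
  replace x with (x - INR k + INR k) by ring. apply Hind. lra.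
Qed.

(** [(-1)^M gbinom (- x - 1) M] is [(x+1) ... (x+M) / M!], which equals
    [Gamma (M + x + 1) / (M! Gamma (x + 1))]. *)
Lemma gauss_product x :
  0 <= x ->
  0 < Gamma (x + 1) /\
  is_lim_seq (fun M => (-1) ^ M * gbinom (- x - 1) M * Rpower (INR M) (- x)) (/ Gamma (x + 1)).
Proof.
  intros Hx.
  assert (Hprod : forall M, Gamma (INR M + x + 1)
            = Gamma (x + 1) * INR (fact M) * ((-1) ^ M * gbinom (- x - 1) M)).
  { induction M as [| M IH].
    - unfold gbinom; simpl. rewrite Rplus_0_l. field.
    - assert (HM := pos_INR M). assert (HF := INR_fact_lt_0 M).
      rewrite S_INR. replace (INR M + 1 + x + 1) with (INR M + x + 1 + 1) by ring.
      rewrite Gamma_succ, IH by lra.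
      unfold gbinom. rewrite fact_simpl, mult_INR, S_INR. cbn [falling pow]. field. lra. }
  assert (Hlim := Gamma_shift_asymptotic x Hx).
  assert (Hge : 0 <= Gamma (x + 1)).
  { refine (is_RInt_pos_le (fun _ => 0) (gamma_density x) 0 _ _ _ (Gamma_correct x Hx)).
    - intros t _. split; [lra | apply Rlt_le, gamma_density_pos].
    - replace 0 with (0 - 0) at 2 by ring.
      apply (is_RInt_pos_primitive (fun _ => 0)).
      + intros t _. auto_derive; [exact I | reflexivity].
      + intros t _. apply continuous_const.
      + apply filterlim_const.
      + apply filterlim_const. }
  assert (Hnz : Gamma (x + 1) <> 0).
  { intros E. apply R1_neq_R0. apply Rbar_finite_eq.
    rewrite <- (is_lim_seq_unique _ _ Hlim), <- (Lim_seq_const 0). apply Lim_seq_ext.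
    intros M. rewrite Hprod, E. unfold Rdiv; ring. }
  split; [lra |].
  assert (H := flim_div _ _ _ _ Hnz Hlim (filterlim_const (Gamma (x + 1)))).
  rewrite Rdiv_1_l in H.
  revert H. apply flim_ext. exists 1%nat. intros M HM.
  assert (HM1 : 1 <= INR M) by (apply (le_INR 1), HM).
  rewrite Hprod, Rpower_Ropp. field.
  repeat split; try exact Hnz; [apply Rgt_not_eq, exp_pos | apply INR_fact_neq_0].
Qed.

(** * Growth of binomial coefficients with a fixed real upper argument *)

Lemma gbinom_succ a k : gbinom a (S k) = gbinom a k * (a - INR k) / (INR k + 1).
Proof.
  unfold gbinom. rewrite fact_simpl, mult_INR, S_INR. cbn [falling].
  assert (Hk := pos_INR k). field. split; [apply INR_fact_neq_0 | lra].
Qed.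

Lemma gbinom_absorb a k : (INR k + 1) * gbinom a (S k) = a * gbinom (a - 1) k.
Proof.
  assert (Hf : forall j, falling a (S j) = a * falling (a - 1) j).
  { induction j as [| j IH].
    - simpl. ring.
    - change (falling a (S (S j))) with (falling a (S j) * (a - INR (S j))).
      rewrite IH, S_INR. cbn [falling]. ring. }
  unfold gbinom. rewrite Hf, fact_simpl, mult_INR, S_INR.
  assert (Hk := pos_INR k). field. split; [apply INR_fact_neq_0 | lra].
Qed.

(** Euler's sine product divided by Gauss's product for [Gamma (x + 1)]; the value
    of the limit is [1 / Gamma (1 - x)] by the reflection formula. *)
Lemma gbinom_pred_asymptotic x :
  0 < x ->
  is_lim_seq (fun M => (-1) ^ M * gbinom (x - 1) M * Rpower (INR M) x)
    (Gamma (x + 1) * sin (PI * x) / (PI * x)).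
Proof.
  intros Hx. assert (HPI := PI_RGT_0).
  destruct (gauss_product x ltac:(lra)) as [HG Hgauss].
  assert (Hsin := euler_sine_product x ltac:(lra)).
  assert (Hnz : / Gamma (x + 1) <> 0) by (apply Rinv_neq_0_compat; lra).
  assert (H := flim_mult _ _ _ _ (flim_div _ _ _ _ Hnz Hsin Hgauss) (filterlim_const (/ x))).
  replace (Gamma (x + 1) * sin (PI * x) / (PI * x))
    with (sin (PI * x) / PI / / Gamma (x + 1) * / x) by (field; lra).
  revert H. apply flim_ext.
  generalize (flim_neq0 _ _ Hnz Hgauss). apply filter_imp. intros M HM.
  rewrite gbinom_absorb. rewrite Rpower_Ropp in HM |- *.
  assert (Hg : gbinom (- x - 1) M <> 0).
  { intros E. apply HM. rewrite E. ring. }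
  assert (Hs := pow_opp1_sqr M).
  assert (Hs0 : (-1) ^ M <> 0) by (apply pow_nonzero; lra).
  assert (Hp : Rpower (INR M) x <> 0) by (apply Rgt_not_eq, exp_pos).
  transitivity (gbinom (x - 1) M * Rpower (INR M) x * ((-1) ^ M * (-1) ^ M) / (-1) ^ M).
  - rewrite Hs. field. repeat split; assumption || lra.
  - field. exact Hs0.
Qed.

Lemma Rpower_INR_succ_ratio a :
  is_lim_seq (fun M => Rpower ((INR M + 1) / INR M) a) 1.
Proof.
  assert (H : is_lim_seq (fun M => (INR M + 1) / INR M) 1).
  { assert (H := flim_plus _ _ _ _ (filterlim_const 1) lim_inv_INR).
    rewrite Rplus_0_r in H. revert H. apply flim_ext. exists 1%nat. intros M HM.
    assert (HM1 : 1 <= INR M) by (apply (le_INR 1), HM). field; lra. }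
  assert (Hp := flim_Rpower _ _ a Rlt_0_1 H).
  unfold Rpower at 2 in Hp. rewrite ln_1, Rmult_0_r, exp_0 in Hp. exact Hp.
Qed.

Lemma gbinom_asymptotic x :
  0 < x ->
  is_lim_seq (fun k => (-1) ^ k * gbinom x k * Rpower (INR k) (x + 1))
    (- (Gamma (x + 1) * sin (PI * x) / PI)).
Proof.
  intros Hx. assert (HPI := PI_RGT_0).
  apply is_lim_seq_incr_1.
  assert (H := flim_mult _ _ _ _ (filterlim_const (- x))
                 (flim_mult _ _ _ _ (gbinom_pred_asymptotic x Hx) (Rpower_INR_succ_ratio x))).
  replace (- (Gamma (x + 1) * sin (PI * x) / PI))
    with (- x * (Gamma (x + 1) * sin (PI * x) / (PI * x) * 1)) by (field; lra).
  revert H. apply flim_ext. exists 1%nat. intros M HM.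
  assert (HM1 : 1 <= INR M) by (apply (le_INR 1), HM).
  rewrite S_INR, Rpower_plus, Rpower_1 by lra.
  assert (Hr : Rpower (INR M + 1) x = Rpower (INR M) x * Rpower ((INR M + 1) / INR M) x).
  { rewrite Rpower_mult_distr by (try apply Rdiv_lt_0_compat; lra). f_equal. field; lra. }
  rewrite Hr. simpl pow.
  transitivity (-1 * (-1) ^ M * ((INR M + 1) * gbinom x (S M))
                * (Rpower (INR M) x * Rpower ((INR M + 1) / INR M) x)); [| ring].
  rewrite gbinom_absorb. ring.
Qed.

(** * Stirling's formula and the binomial coefficient at a fixed proportion *)

Definition stirling_error (n : nat) : R :=
  ln (INR (fact n)) - (INR n + / 2) * ln (INR n) + INR n.

(** Equality holds at [u = 0], and the differences have nonnegative derivatives; both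
    bounds agree with [ln] to second order, which the Stirling steps require. *)
Lemma ln_1p_bounds u :
  0 < u -> 2 * u / (2 + u) <= ln (1 + u) <= u * (u + 2) / (2 * (1 + u)).
Proof.
  intros Hu.
  assert (Hmono : forall h dh : R -> R, h 0 = 0 ->
    (forall t, 0 <= t -> is_derive h t (dh t)) -> (forall t, 0 <= t -> 0 <= dh t) -> 0 <= h u).
  { intros h dh H0 Hd Hpos.
    destruct (MVT_gen h 0 u dh) as [c [Hc E]].
    - intros t Ht. rewrite Rmin_left in Ht by lra. apply Hd; lra.
    - intros t Ht. rewrite Rmin_left in Ht by lra. apply continuity_pt_filterlim.
      apply (ex_derive_continuous h). exists (dh t). apply Hd; lra.
    - rewrite Rmin_left, Rmax_right in Hc by lra.
      assert (0 <= dh c * (u - 0)) by (apply Rmult_le_pos; [apply Hpos |]; lra). lra. }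
  split.
  - apply Rminus_le_0.
    apply (Hmono (fun t => ln (1 + t) - 2 * t / (2 + t)) (fun t => t ^ 2 / ((1 + t) * (2 + t) ^ 2))).
    + rewrite Rplus_0_r, ln_1. field.
    + intros t Ht. auto_derive; [lra | field; lra].
    + intros t Ht. apply Rdiv_le_0_compat; [nra |]. apply Rmult_lt_0_compat; nra.
  - apply Rminus_le_0.
    apply (Hmono (fun t => t * (t + 2) / (2 * (1 + t)) - ln (1 + t)) (fun t => t ^ 2 / (2 * (1 + t) ^ 2))).
    + rewrite Rplus_0_r, ln_1. field.
    + intros t Ht. auto_derive; [lra | field; lra].
    + intros t Ht. apply Rdiv_le_0_compat; nra.
Qed.

Lemma stirling_error_step n :
  (1 <= n)%nat ->
  0 <= stirling_error n - stirling_error (S n) <= / (4 * INR n) - / (4 * INR (S n)).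
Proof.
  intros Hn. assert (Hn1 : 1 <= INR n) by (apply (le_INR 1), Hn).
  assert (HF := INR_fact_lt_0 n).
  assert (E : stirling_error n - stirling_error (S n) = (INR n + / 2) * ln (1 + / INR n) - 1).
  { unfold stirling_error. rewrite fact_simpl, mult_INR, S_INR.
    rewrite ln_mult by lra.
    replace (1 + / INR n) with ((INR n + 1) / INR n) by (field; lra).
    rewrite ln_div by lra. field. }
  rewrite E, S_INR.
  destruct (ln_1p_bounds (/ INR n) ltac:(apply Rinv_0_lt_compat; lra)) as [H1 H2].
  apply (Rmult_le_compat_l (INR n + / 2)) in H1; [| lra].
  apply (Rmult_le_compat_l (INR n + / 2)) in H2; [| lra].
  replace ((INR n + / 2) * (2 * / INR n / (2 + / INR n))) with 1 in H1 by (field; lra).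
  replace ((INR n + / 2) * (/ INR n * (/ INR n + 2) / (2 * (1 + / INR n))))
    with (1 + (/ (4 * INR n) - / (4 * (INR n + 1)))) in H2 by (field; lra).
  lra.
Qed.

(** The steps telescope: the error decreases, and it increases after subtracting
    [1 / (4 n)]. *)
Lemma stirling_error_converges : ex_finite_lim_seq stirling_error.
Proof.
  enough (H : ex_finite_lim_seq (fun n => stirling_error (S n))).
  { destruct H as [l Hl]. exists l. apply is_lim_seq_incr_1, Hl. }
  apply (ex_finite_lim_seq_decr _ (stirling_error 1 - / 4)).
  - intros n. generalize (stirling_error_step (S n) ltac:(lia)). lra.
  - intros n.
    assert (H : stirling_error 1 - / 4 <= stirling_error (S n) - / (4 * INR (S n))).
    { induction n as [| n IH].
      - simpl INR. apply Req_le. field.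
      - generalize (stirling_error_step (S n) ltac:(lia)). lra. }
    assert (Hn : 0 < INR (S n)) by (apply lt_0_INR; lia).
    assert (0 < / (4 * INR (S n))) by (apply Rinv_0_lt_compat; lra). lra.
Qed.

(** Euler's product at [1/2] is Wallis's product in terms of [(2k)!] and [k!]. *)
Lemma wallis_product :
  is_lim_seq (fun k => INR (fact (2 * k)) ^ 2 * (2 * INR k + 1) / (2 * 16 ^ k * INR (fact k) ^ 4)) (/ PI).
Proof.
  assert (H := euler_sine_product (/ 2) ltac:(lra)).
  replace (sin (PI * / 2) / PI) with (/ PI) in H.
  2: { replace (PI * / 2) with (PI / 2) by reflexivity. rewrite sin_PI2. unfold Rdiv; ring. }
  revert H. apply is_lim_seq_ext. intros k.
  induction k as [| k IH].
  - unfold gbinom; simpl. field.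
  - assert (Hk := pos_INR k). assert (HF := INR_fact_neq_0 k).
    replace (2 * S k)%nat with (S (S (2 * k))) by lia.
    rewrite !(fact_simpl (S (2 * k))), (fact_simpl (2 * k)), (fact_simpl k), !mult_INR, !S_INR.
    rewrite mult_INR. simpl (INR 2).
    rewrite (gbinom_succ (/ 2) (S k)), (gbinom_succ (- / 2 - 1) k), S_INR. simpl (16 ^ S k).
    transitivity ((INR k + 1) * gbinom (/ 2) (S k) * gbinom (- / 2 - 1) k
                  * ((/ 2 - (INR k + 1)) * (- / 2 - 1 - INR k) / (INR k + 1) ^ 2)); [field; lra |].
    rewrite IH. field. repeat split; try lra; try exact HF. apply pow_nonzero; lra.
Qed.

(** Wallis's product identifies the limit [c], through
    [2 (c - 2 c) = ln (1 / PI) - ln 2]. *)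
Lemma stirling : is_lim_seq stirling_error (ln (2 * PI) / 2).
Proof.
  assert (HPI := PI_RGT_0).
  destruct stirling_error_converges as [c Hc].
  assert (H2 : is_lim_seq (fun k => stirling_error (2 * k)) c).
  { apply (is_lim_seq_subseq stirling_error c (fun k => (2 * k)%nat)); [| exact Hc].
    apply eventually_subseq. intros k; lia. }
  assert (L1 : is_lim_seq (fun k => 2 * (stirling_error (2 * k) - 2 * stirling_error k)) (2 * (c - 2 * c))).
  { apply flim_mult; [apply filterlim_const |]. apply flim_minus; [exact H2 |].
    apply flim_mult; [apply filterlim_const | exact Hc]. }
  assert (Hhalf : is_lim_seq (fun k => / (2 + / INR k)) (/ 2)).
  { assert (H := flim_plus _ _ _ _ (filterlim_const 2) lim_inv_INR).
    rewrite Rplus_0_r in H. apply flim_inv; [lra | exact H]. }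
  assert (L2 : is_lim_seq (fun k => 2 * (stirling_error (2 * k) - 2 * stirling_error k)) (ln (/ PI * / 2))).
  { assert (H : is_lim_seq (fun k => ln ((INR (fact (2 * k)) ^ 2 * (2 * INR k + 1) / (2 * 16 ^ k * INR (fact k) ^ 4))
         * / (2 + / INR k))) (ln (/ PI * / 2))).
    { assert (Hpos : 0 < / PI * / 2) by (apply Rmult_lt_0_compat; apply Rinv_0_lt_compat; lra).
      apply (flim_continuous ln).
      - apply (ex_derive_continuous ln). auto_derive. exact Hpos.
      - apply flim_mult; [exact wallis_product | exact Hhalf]. }
    revert H. apply flim_ext. exists 1%nat. intros k Hk.
    assert (Hk1 : 1 <= INR k) by (apply (le_INR 1), Hk).
    assert (F1 := INR_fact_lt_0 k). assert (F2 := INR_fact_lt_0 (2 * k)).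
    assert (H16 : 0 < 16 ^ k) by (apply pow_lt; lra).
    replace (/ (2 + / INR k)) with (INR k / (2 * INR k + 1)) by (field; lra).
    replace (INR (fact (2 * k)) ^ 2 * (2 * INR k + 1) / (2 * 16 ^ k * INR (fact k) ^ 4) * (INR k / (2 * INR k + 1)))
      with (INR (fact (2 * k)) ^ 2 * INR k / (2 * 16 ^ k * INR (fact k) ^ 4)) by (field; lra).
    rewrite ln_div, !ln_mult, !ln_pow; try lra; try apply pow_lt; try lra;
      repeat apply Rmult_lt_0_compat; try apply pow_lt; try lra.
    replace 16 with (2 ^ 4) by ring. rewrite ln_pow by lra.
    unfold stirling_error. rewrite !mult_INR. simpl (INR 2). simpl (INR 4).
    rewrite ln_mult by lra. replace (1 + 1) with 2 by ring. field. }
  assert (E : ln (/ PI * / 2) = 2 * (c - 2 * c)).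
  { apply Rbar_finite_eq. rewrite <- (is_lim_seq_unique _ _ L1). symmetry.
    apply is_lim_seq_unique, L2. }
  rewrite <- Rinv_mult, ln_Rinv in E by lra. rewrite Rmult_comm in E.
  replace (ln (2 * PI) / 2) with c by lra. exact Hc.
Qed.

Lemma gbinom_INR N j : (j <= N)%nat -> gbinom (INR N) j = Binomial.C N j.
Proof.
  intros Hj.
  assert (H : falling (INR N) j * INR (fact (N - j)) = INR (fact N)).
  { induction j as [| j IH].
    - simpl. rewrite Nat.sub_0_r. ring.
    - rewrite <- IH by lia. replace (N - j)%nat with (S (N - S j)) by lia.
      rewrite fact_simpl, mult_INR. cbn [falling].
      replace (S (N - S j)) with (N - j)%nat by lia. rewrite minus_INR by lia. ring. }
  unfold gbinom, Binomial.C. rewrite <- H. field. split; apply INR_fact_neq_0.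
Qed.

Lemma flim_nat_infty {T} {F : (T -> Prop) -> Prop} {FF : Filter F} (f g : T -> nat) (c : R) :
  0 < c -> filterlim g F eventually -> F (fun t => c * INR (g t) <= INR (f t)) ->
  filterlim f F eventually.
Proof.
  intros Hc Hg Hfg P [N0 HP].
  assert (Hev : eventually (fun k => INR N0 / c < INR k)).
  { destruct (INR_unbounded (INR N0 / c)) as [K HK]. exists K. intros k Hk.
    apply le_INR in Hk. lra. }
  assert (Hg' : F (fun t => INR N0 / c < INR (g t))) by exact (Hg _ Hev).
  change (F (fun t => P (f t))). generalize (filter_and _ _ Hg' Hfg).
  apply filter_imp. intros t [H1 H2]. apply HP, INR_le.
  apply (Rmult_lt_compat_l c) in H1; [| exact Hc].
  replace (c * (INR N0 / c)) with (INR N0) in H1 by (field; lra). lra.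
Qed.

Lemma flim_seq {T} {F : (T -> Prop) -> Prop} (u : nat -> R) (f : T -> nat) (l : R) :
  is_lim_seq u l -> filterlim f F eventually -> filterlim (fun t => u (f t)) F (locally l).
Proof. intros Hu Hf. exact (filterlim_comp _ _ _ f u F _ _ Hf Hu). Qed.

Lemma eventually_INR_gt a : eventually (fun N => a < INR N).
Proof.
  destruct (INR_unbounded a) as [K HK]. exists K. intros k Hk. apply le_INR in Hk. lra.
Qed.

Lemma ln_sqrt a : 0 < a -> ln (sqrt a) = / 2 * ln a.
Proof. intros Ha. rewrite <- Rpower_sqrt by exact Ha. apply ln_Rpower. Qed.

(** The powers of [N] and the entropy cancel exactly because [n = z N]; what is left
    is the exponential of Stirling errors. *)
Lemma central_binomial_asymptotic {F : (nat -> Prop) -> Prop} {FF : Filter F} (z : R) (n : nat -> nat) :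
  0 < z < 1 -> filter_le F eventually -> F (fun N => INR (n N) = z * INR N) ->
  filterlim (fun N => gbinom (INR N) (n N)
      / (sqrt (1 / INR N) / (sqrt (2 * PI) * sqrt (z * (1 - z)))
         * exp (INR N * ((z - 1) * ln (1 - z) - z * ln z))))
    F (locally 1).
Proof.
  intros Hz HF Hn. assert (HPI := PI_RGT_0).
  assert (HN : filterlim (fun N : nat => N) F eventually) by (intros P HP; apply HF, HP).
  assert (Hle : F (fun N => (n N <= N)%nat)).
  { revert Hn; apply filter_imp; intros N H. apply INR_le. generalize (pos_INR N). nra. }
  assert (Hn_inf : filterlim n F eventually).
  { apply (flim_nat_infty n (fun N => N) z); [lra | exact HN |].
    revert Hn; apply filter_imp; intros N H; lra. }
  assert (Hc_inf : filterlim (fun N => (N - n N)%nat) F eventually).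
  { apply (flim_nat_infty _ (fun N => N) (1 - z)); [lra | exact HN |].
    generalize (filter_and _ _ Hn Hle); apply filter_imp; intros N [H1 H2].
    rewrite minus_INR, H1 by exact H2. lra. }
  assert (Hlim : filterlim (fun N => exp (stirling_error N - stirling_error (n N)
                    - stirling_error (N - n N) + ln (2 * PI) / 2)) F (locally 1)).
  { rewrite <- exp_0.
    replace 0 with (ln (2 * PI) / 2 - ln (2 * PI) / 2 - ln (2 * PI) / 2 + ln (2 * PI) / 2) by ring.
    apply (flim_continuous exp).
    - apply (ex_derive_continuous exp). auto_derive. exact I.
    - apply flim_plus; [apply flim_minus; [apply flim_minus |] | apply filterlim_const];
        apply flim_seq; try exact stirling; assumption. }
  revert Hlim. apply flim_ext.
  generalize (filter_and _ _ (filter_and _ _ Hn Hle) (HF _ (eventually_INR_gt 0))).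
  apply filter_imp. intros N [[H1 H2] H3].
  rewrite gbinom_INR by exact H2. unfold Binomial.C.
  assert (F1 := INR_fact_lt_0 N). assert (F2 := INR_fact_lt_0 (n N)).
  assert (F3 := INR_fact_lt_0 (N - n N)).
  assert (Hz1 : 0 < z * (1 - z)) by (apply Rmult_lt_0_compat; lra).
  assert (H1N : 0 < 1 / INR N) by (apply Rdiv_lt_0_compat; lra).
  set (D := sqrt (1 / INR N) / (sqrt (2 * PI) * sqrt (z * (1 - z)))
         * exp (INR N * ((z - 1) * ln (1 - z) - z * ln z))).
  assert (Hsq : forall a, 0 < a -> 0 < sqrt a) by (intros; apply sqrt_lt_R0; assumption).
  assert (HD : 0 < D).
  { apply Rmult_lt_0_compat; [| apply exp_pos].
    apply Rdiv_lt_0_compat; [| apply Rmult_lt_0_compat]; apply Hsq; lra. }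
  assert (HR : 0 < INR (fact N) / (INR (fact (n N)) * INR (fact (N - n N))) / D).
  { apply Rdiv_lt_0_compat; [| exact HD]. apply Rdiv_lt_0_compat; [lra |].
    apply Rmult_lt_0_compat; lra. }
  rewrite <- (exp_ln _ HR). f_equal.
  rewrite !ln_div; try lra; try (apply Rmult_lt_0_compat; lra).
  2: apply Rdiv_lt_0_compat; [| apply Rmult_lt_0_compat]; lra.
  assert (HlnD : ln D = ln (sqrt (1 / INR N)) - ln (sqrt (2 * PI) * sqrt (z * (1 - z)))
                        + INR N * ((z - 1) * ln (1 - z) - z * ln z)).
  { unfold D. rewrite ln_mult, ln_exp, ln_div; try apply exp_pos; try reflexivity;
      try apply Rdiv_lt_0_compat; try apply Rmult_lt_0_compat; apply Hsq; lra. }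
  rewrite HlnD.
  rewrite !ln_mult; try (apply Hsq; lra); try lra.
  rewrite !ln_sqrt by lra.
  rewrite ln_div, ln_1, (ln_mult z) by lra.
  unfold stirling_error. rewrite minus_INR, H1 by exact H2.
  replace (INR N - z * INR N) with ((1 - z) * INR N) by ring.
  rewrite !ln_mult by lra. field.
Qed.

(** * Concentration of the binomial distribution *)

Definition binomial_weight (p q : R) (N j : nat) : R := Binomial.C N j * p ^ j * q ^ (N - j).

(** The pairs [(N, j)] with [N] large along [F] and [j / N] close to [p], where almost
    all the binomial mass lies. *)
Definition bulk (F : (nat -> Prop) -> Prop) (p : R) : (nat * nat -> Prop) -> Prop :=
  fun P => exists delta, 0 < delta /\
    F (fun N => forall j, (j <= N)%nat -> Rabs (INR j - p * INR N) <= delta * INR N -> P (N, j)).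

Instance bulk_filter F p : Filter F -> Filter (bulk F p).
Proof.
  intros FF. constructor.
  - exists 1. split; [lra |]. apply filter_forall. easy.
  - intros P Q [d1 [H1 HP]] [d2 [H2 HQ]].
    exists (Rmin d1 d2). split; [apply Rmin_glb_lt; assumption |].
    generalize (filter_and _ _ HP HQ). apply filter_imp. intros N [A B] j Hj Hd.
    assert (HN := pos_INR N).
    split; [apply A | apply B]; try exact Hj; apply Rle_trans with (1 := Hd);
      apply Rmult_le_compat_r; try lra; [apply Rmin_l | apply Rmin_r].
  - intros P Q HPQ [d [H HP]]. exists d. split; [exact H |].
    revert HP. apply filter_imp. intros N HN j Hj Hd. apply HPQ, HN; assumption.
Qed.

(** From [exp (- y) >= 1 - y] and [(1 - y) (1 + y + 2 y^2) = 1 + y^2 (1 - 2 y)]. *)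
Lemma exp_le_quadratic y : y <= / 2 -> exp y <= 1 + y + 2 * y ^ 2.
Proof.
  intros Hy. assert (H := exp_ineq1_le (- y)). rewrite exp_Ropp in H.
  assert (He := exp_pos y).
  apply (Rmult_le_compat_r (exp y)) in H; [| lra]. rewrite Rinv_l in H by lra.
  apply (Rmult_le_reg_l (1 - y)); [lra |]. nra.
Qed.

Lemma exp_pow a k : exp a ^ k = exp (INR k * a).
Proof.
  induction k as [| k IH].
  - simpl. rewrite Rmult_0_l, exp_0. reflexivity.
  - rewrite <- tech_pow_Rmult, IH, <- exp_plus, S_INR. f_equal. ring.
Qed.

Lemma binomial_weight_exp_moment p q N s :
  sum_f_R0 (fun j => exp (s * (INR j - p * INR N)) * binomial_weight p q N j) N
  = (exp (- (s * p)) * (p * exp s + q)) ^ N.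
Proof.
  rewrite Rpow_mult_distr, binomial, scal_sum. apply sum_eq. intros j Hj.
  unfold binomial_weight.
  rewrite Rpow_mult_distr, !exp_pow.
  replace (s * (INR j - p * INR N)) with (INR j * s + INR N * - (s * p)) by ring.
  rewrite exp_plus. ring.
Qed.

(** After centring at [p N], the first-order terms of [p exp (s q) + q exp (- s p)] cancel. *)
Lemma binomial_weight_exp_moment_le p q N s :
  0 < p -> 0 < q -> p + q = 1 -> Rabs s <= / 2 ->
  sum_f_R0 (fun j => exp (s * (INR j - p * INR N)) * binomial_weight p q N j) N
  <= exp (2 * s ^ 2 * INR N).
Proof.
  intros Hp Hq Hpq Hs. rewrite binomial_weight_exp_moment.
  apply Rabs_le_between in Hs.
  assert (E : exp (- (s * p)) * (p * exp s + q) = p * exp (s * q) + q * exp (- (s * p))).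
  { replace (s * q) with (s + - (s * p)) by (replace q with (1 - p) by lra; ring).
    rewrite exp_plus. ring. }
  rewrite E.
  assert (H1 := exp_le_quadratic (s * q) ltac:(nra)).
  assert (H2 := exp_le_quadratic (- (s * p)) ltac:(nra)).
  assert (H3 := exp_ineq1_le (2 * s ^ 2)).
  assert (Hs2 : 0 <= s ^ 2) by nra.
  assert (Hpq1 : p * q <= 1) by nra.
  assert (H4 : p * exp (s * q) + q * exp (- (s * p)) <= exp (2 * s ^ 2)).
  { apply Rle_trans with (p * (1 + s * q + 2 * (s * q) ^ 2) + q * (1 + - (s * p) + 2 * (- (s * p)) ^ 2)).
    - apply Rplus_le_compat; apply Rmult_le_compat_l; lra.
    - replace (p * (1 + s * q + 2 * (s * q) ^ 2) + q * (1 + - (s * p) + 2 * (- (s * p)) ^ 2))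
        with ((p + q) + 2 * s ^ 2 * (p * q * (p + q))) by ring.
      rewrite Hpq. nra. }
  replace (exp (2 * s ^ 2 * INR N)) with (exp (2 * s ^ 2) ^ N).
  - apply pow_incr. split; [| exact H4].
    assert (He1 := exp_pos (s * q)). assert (He2 := exp_pos (- (s * p))). nra.
  - rewrite exp_pow. f_equal. ring.
Qed.

Lemma binomial_weight_nonneg p q N j : 0 < p -> 0 < q -> 0 <= binomial_weight p q N j.
Proof.
  intros Hp Hq. unfold binomial_weight, Binomial.C.
  apply Rmult_le_pos; [apply Rmult_le_pos |]; try (apply pow_le; lra).
  apply Rdiv_le_0_compat; [apply pos_INR |].
  apply Rmult_lt_0_compat; apply INR_fact_lt_0.
Qed.

Lemma binomial_weight_sum p q N : p + q = 1 -> sum_f_R0 (binomial_weight p q N) N = 1.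
Proof. intros Hpq. unfold binomial_weight. rewrite <- binomial, Hpq. apply pow1. Qed.

Lemma power_exp_decay a c :
  0 < a -> 0 < c -> is_lim_seq (fun N => Rpower (INR N) a * exp (- (c * INR N))) 0.
Proof.
  intros Ha Hc.
  assert (Hinf : filterlim (fun N => c * INR N) eventually (Rbar_locally p_infty)).
  { intros P [M HM]. change (eventually (fun N => P (c * INR N))).
    generalize (eventually_INR_gt (M / c)). apply filter_imp. intros N HN. apply HM.
    apply (Rmult_lt_compat_l c) in HN; [| exact Hc].
    replace (c * (M / c)) with M in HN by (field; lra). exact HN. }
  assert (H := filterlim_comp _ _ _ _ _ _ _ _ Hinf (gamma_density_lim_infty a Ha)).
  assert (H' := flim_mult _ _ _ _ (filterlim_const (/ Rpower c a)) H).
  rewrite Rmult_0_r in H'. revert H'. apply flim_ext.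
  generalize (eventually_INR_gt 0). apply filter_imp. intros N HN.
  unfold gamma_density. rewrite <- Rpower_mult_distr by assumption.
  field. apply Rgt_not_eq, exp_pos.
Qed.

(** Outside the window the weights carry mass at most [2 exp (- delta^2 N / 8)] by
    Chernoff's bound with exponents [delta / 4] and [- delta / 4], which beats the
    polynomial growth of [h]. *)
Lemma binomial_concentration {F : (nat -> Prop) -> Prop} {FF : Filter F} (p q : R)
    (h : nat * nat -> R) (l C d : R) :
  0 < p -> 0 < q -> p + q = 1 -> filter_le F eventually ->
  filterlim h (bulk F p) (locally l) ->
  0 < d -> F (fun N => forall j, (j <= N)%nat -> Rabs (h (N, j)) <= C * Rpower (INR N) d) ->
  filterlim (fun N => sum_f_R0 (fun j => h (N, j) * binomial_weight p q N j) N) F (locally l).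
Proof.
  intros Hp Hq Hpq HF Hh Hd Hbound. apply flim_eps. intros eps.
  destruct (proj2 (flim_eps _ _) Hh (pos_div_2 eps)) as [delta0 [Hdelta0 Hin]].
  set (delta := Rmin delta0 1).
  assert (Hdelta : 0 < delta) by (apply Rmin_glb_lt; lra).
  assert (Hdelta1 : delta <= 1) by apply Rmin_r.
  assert (Hdelta2 : delta <= delta0) by apply Rmin_l.
  set (c := delta ^ 2 / 8). assert (Hc : 0 < c) by (unfold c; nra).
  set (tail := fun N => 2 * (C + Rabs l) * (Rpower (INR N) d * exp (- (c * INR N)))).
  assert (Htail : is_lim_seq tail 0).
  { assert (H := flim_mult _ _ _ _ (filterlim_const (2 * (C + Rabs l))) (power_exp_decay d c Hd Hc)).
    rewrite Rmult_0_r in H. exact H. }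
  generalize (HF _ (proj2 (flim_eps _ _) Htail (pos_div_2 eps))).
  generalize (filter_and _ _ (filter_and _ _ Hin Hbound) (HF _ (eventually_INR_gt 1))).
  intros HA HB. generalize (filter_and _ _ HA HB). clear HA HB.
  apply filter_imp. intros N [[[Hclose Hb] HN] Htl].
  simpl in Hclose, Htl. rewrite Rminus_0_r in Htl.
  set (w := binomial_weight p q N).
  assert (Hw : forall j, 0 <= w j) by (intros j; apply binomial_weight_nonneg; assumption).
  assert (Hw1 : sum_f_R0 w N = 1) by (apply binomial_weight_sum, Hpq).
  assert (HNd : 1 <= Rpower (INR N) d).
  { rewrite <- (Rpower_O (INR N)) by lra. apply Rle_Rpower; lra. }
  set (s := delta / 4). set (B := (C + Rabs l) * Rpower (INR N) d * exp (- (s * delta * INR N))).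
  assert (HCl : 0 <= C * Rpower (INR N) d + Rabs l).
  { assert (H0 := Hb 0%nat ltac:(lia)). generalize (Rabs_pos (h (N, 0%nat))) (Rabs_pos l). lra. }
  set (e1 := fun j => exp (s * (INR j - p * INR N))).
  set (e2 := fun j => exp (- s * (INR j - p * INR N))).
  assert (Hterm : forall j, (j <= N)%nat ->
            Rabs (h (N, j) * w j - l * w j) <= eps / 2 * w j + (B * (e1 j * w j) + B * (e2 j * w j))).
  { intros j Hj.
    replace (h (N, j) * w j - l * w j) with ((h (N, j) - l) * w j) by ring.
    rewrite Rabs_mult, (Rabs_pos_eq (w j)) by apply Hw.
    replace (eps / 2 * w j + (B * (e1 j * w j) + B * (e2 j * w j)))
      with ((eps / 2 + (B * e1 j + B * e2 j)) * w j) by ring.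
    apply Rmult_le_compat_r; [apply Hw |].
    assert (He1 : 0 < e1 j) by apply exp_pos. assert (He2 : 0 < e2 j) by apply exp_pos.
    assert (Hl := Rabs_pos l).
    assert (Hmul : Rabs l <= Rabs l * Rpower (INR N) d).
    { rewrite <- (Rmult_1_r (Rabs l)) at 1. apply Rmult_le_compat_l; lra. }
    assert (HB0 : C * Rpower (INR N) d + Rabs l <= (C + Rabs l) * Rpower (INR N) d)
      by (rewrite Rmult_plus_distr_r; lra).
    assert (Hexp := exp_pos (- (s * delta * INR N))).
    assert (HB : 0 <= B) by (apply Rmult_le_pos; lra).
    assert (HBe : 0 <= B * e1 j /\ 0 <= B * e2 j) by (split; apply Rmult_le_pos; lra).
    destruct (Rle_dec (Rabs (INR j - p * INR N)) (delta * INR N)) as [Hd' | Hd'].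
    - assert (Hx : Rabs (h (N, j) - l) < eps / 2).
      { apply Hclose; [exact Hj |]. apply Rle_trans with (1 := Hd').
        apply Rmult_le_compat_r; lra. }
      lra.
    - apply Rnot_le_lt in Hd'.
      assert (Hout : 1 <= exp (- (s * delta * INR N)) * (e1 j + e2 j)).
      { unfold e1, e2. rewrite Rmult_plus_distr_l, <- !exp_plus.
        assert (Hs : 0 < s) by (unfold s; lra).
        assert (G1 := exp_pos (- (s * delta * INR N) + s * (INR j - p * INR N))).
        assert (G2 := exp_pos (- (s * delta * INR N) + - s * (INR j - p * INR N))).
        unfold Rabs in Hd'. destruct (Rcase_abs (INR j - p * INR N)).
        - assert (K := exp_ineq1_le (- (s * delta * INR N) + - s * (INR j - p * INR N))). nra.
        - assert (K := exp_ineq1_le (- (s * delta * INR N) + s * (INR j - p * INR N))). nra. }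
      assert (Htri : Rabs (h (N, j) - l) <= C * Rpower (INR N) d + Rabs l).
      { unfold Rminus. apply Rle_trans with (1 := Rabs_triang _ _). rewrite Rabs_Ropp.
        apply Rplus_le_compat_r, Hb, Hj. }
      assert (Hfin : (C + Rabs l) * Rpower (INR N) d <= B * e1 j + B * e2 j).
      { replace (B * e1 j + B * e2 j)
          with ((C + Rabs l) * Rpower (INR N) d * (exp (- (s * delta * INR N)) * (e1 j + e2 j)))
          by (unfold B; ring).
        rewrite <- (Rmult_1_r ((C + Rabs l) * Rpower (INR N) d)) at 1.
        apply Rmult_le_compat_l; lra. }
      generalize (cond_pos eps). lra. }
  replace (sum_f_R0 (fun j => h (N, j) * w j) N - l)
    with (sum_f_R0 (fun j => h (N, j) * w j - l * w j) N).
  2: { rewrite minus_sum, <- (sum_eq (fun j => w j * l) (fun j => l * w j)) by (intros; ring).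
       rewrite <- scal_sum, Hw1. ring. }
  apply Rle_lt_trans with (1 := Rsum_abs _ _).
  apply Rle_lt_trans with (1 := sum_Rle _ _ _ Hterm).
  rewrite !plus_sum.
  rewrite <- (sum_eq (fun j => w j * (eps / 2)) (fun j => eps / 2 * w j)) by (intros; ring).
  rewrite <- (sum_eq (fun j => e1 j * w j * B) (fun j => B * (e1 j * w j))) by (intros; ring).
  rewrite <- (sum_eq (fun j => e2 j * w j * B) (fun j => B * (e2 j * w j))) by (intros; ring).
  rewrite <- !scal_sum, Hw1.
  assert (Hs4 : Rabs s <= / 2) by (unfold s; rewrite Rabs_pos_eq; lra).
  assert (M1 := binomial_weight_exp_moment_le p q N s Hp Hq Hpq Hs4).
  assert (M2 := binomial_weight_exp_moment_le p q N (- s) Hp Hq Hpq ltac:(rewrite Rabs_Ropp; exact Hs4)).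
  fold w in M1, M2. replace ((- s) ^ 2) with (s ^ 2) in M2 by ring.
  assert (HB : 0 <= B).
  { apply Rmult_le_pos; [| apply Rlt_le, exp_pos].
    apply Rle_trans with (1 := HCl). rewrite Rmult_plus_distr_r.
    apply Rplus_le_compat_l. rewrite <- (Rmult_1_r (Rabs l)) at 1.
    apply Rmult_le_compat_l; [apply Rabs_pos | exact HNd]. }
  apply (Rmult_le_compat_l _ _ _ HB) in M1. apply (Rmult_le_compat_l _ _ _ HB) in M2.
  assert (E : B * exp (2 * s ^ 2 * INR N) = tail N / 2).
  { unfold B, tail. rewrite Rmult_assoc, <- exp_plus.
    replace (- (s * delta * INR N) + 2 * s ^ 2 * INR N) with (- (c * INR N)) by (unfold s, c; field).
    field. }
  rewrite E in M1, M2.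
  change (B * sum_f_R0 (fun j => e1 j * w j) N <= tail N / 2) in M1.
  change (B * sum_f_R0 (fun j => e2 j * w j) N <= tail N / 2) in M2.
  generalize (Rle_abs (tail N)). lra.
Qed.

(** * The dominant binomial average when [sin (PI * x) <> 0] *)

Lemma sum_f_R0_truncate (f : nat -> R) n N :
  (n <= N)%nat -> (forall j, (n < j <= N)%nat -> f j = 0) -> sum_f_R0 f N = sum_f_R0 f n.
Proof.
  intros HnN Hf. induction N as [| N IH].
  - replace n with 0%nat by lia. reflexivity.
  - destruct (Nat.eq_dec n (S N)) as [-> | Hne]; [reflexivity |].
    simpl. rewrite Hf by lia. rewrite IH; [ring | lia |]. intros j Hj. apply Hf. lia.
Qed.

(** [gbinom (N - x) j / gbinom N j] is the product of [1 - x/i] over [N - j < i <= N],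
    and [(-1)^M gbinom (x - 1) M] is the same product over [1 <= i <= M]. *)
Lemma gbinom_shift_ratio x N j :
  (j <= N)%nat ->
  gbinom (INR N - x) j * ((-1) ^ (N - j) * gbinom (x - 1) (N - j))
  = gbinom (INR N) j * ((-1) ^ N * gbinom (x - 1) N).
Proof.
  induction j as [| j IH]; intros Hj.
  - rewrite Nat.sub_0_r. unfold gbinom; simpl. field. apply INR_fact_neq_0.
  - rewrite !gbinom_succ. specialize (IH ltac:(lia)).
    replace (N - j)%nat with (S (N - S j)) in IH by lia.
    rewrite gbinom_succ in IH. simpl pow in IH.
    assert (E : INR (N - S j) + 1 = INR N - INR j).
    { rewrite <- S_INR. replace (S (N - S j)) with (N - j)%nat by lia. apply minus_INR; lia. }
    assert (Hpos := pos_INR (N - S j)). assert (Hj0 := pos_INR j).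
    set (s := (-1) ^ (N - S j)) in *. set (g := gbinom (x - 1) (N - S j)) in *.
    transitivity (gbinom (INR N - x) j * (-1 * s * (g * (x - 1 - INR (N - S j)) / (INR (N - S j) + 1)))
                  * ((INR N - INR j) / (INR j + 1))).
    + replace (INR N - x - INR j) with (- (x - 1 - INR (N - S j))) by lra.
      rewrite <- E. field. lra.
    + rewrite IH. field. lra.
Qed.

(** What is averaged over the binomial law of [j = n - k] in the Krawtchouk sum, scaled
    so as to converge near [j = p N]. It takes a pair because its limit is taken along
    [bulk], and it is extended by [0] to [n < j <= N]. *)
Definition averaged_term (x : R) (n : nat -> nat) (Nj : nat * nat) : R :=
  let (N, j) := Nj in
  if (j <=? n N)%nat
  then Rpower (INR N) (x + 1) * ((-1) ^ (n N - j) * gbinom x (n N - j))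
       * (gbinom (INR N - x) j / gbinom (INR N) j)
  else 0.

Lemma gbinom_INR_pos N j : (j <= N)%nat -> 0 < gbinom (INR N) j.
Proof.
  intros Hj. rewrite gbinom_INR by exact Hj. unfold Binomial.C.
  apply Rdiv_lt_0_compat; [apply INR_fact_lt_0 |].
  apply Rmult_lt_0_compat; apply INR_fact_lt_0.
Qed.

(** [q^k = q^n / q^j], so that [p^j q^k] is [q^n / q^N] times the binomial weight
    [p^j q^(N-j)]; the signs combine to [(-1)^n (-1)^k]. *)
Lemma krawtchouk_as_average p q n N x :
  0 < q -> 0 < INR N -> (n N <= N)%nat ->
  (-1) ^ n N * krawtchouk p q (n N) N x * Rpower (INR N) (x + 1)
  = q ^ n N / q ^ N * sum_f_R0 (fun j => averaged_term x n (N, j) * binomial_weight p q N j) N.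
Proof.
  intros Hq HN Hn.
  rewrite (sum_f_R0_truncate _ (n N) N Hn).
  2: { intros j Hj. unfold averaged_term. rewrite (proj2 (Nat.leb_gt j (n N))) by lia. ring. }
  unfold krawtchouk.
  rewrite <- (sum_f_R0_skip (fun j => averaged_term x n (N, j) * binomial_weight p q N j)).
  rewrite !scal_sum, (Rmult_comm _ (Rpower _ _)), scal_sum.
  apply sum_eq. intros k Hk.
  unfold averaged_term, binomial_weight.
  rewrite (proj2 (Nat.leb_le (n N - k) (n N))) by lia.
  replace (n N - (n N - k))%nat with k by lia.
  assert (Hg := gbinom_INR_pos N (n N - k) ltac:(lia)).
  rewrite <- gbinom_INR by lia.
  assert (Hqpow : q ^ N = q ^ (N - (n N - k)) * (q ^ n N / q ^ k)).
  { replace (q ^ n N) with (q ^ k * q ^ (n N - k)).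
    - replace (q ^ N) with (q ^ (N - (n N - k)) * q ^ (n N - k)) by (rewrite <- pow_add; f_equal; lia).
      field. apply pow_nonzero; lra.
    - rewrite <- pow_add. f_equal. lia. }
  replace ((- p) ^ (n N - k)) with ((-1) ^ (n N - k) * p ^ (n N - k)).
  2: { rewrite <- Rpow_mult_distr. f_equal. ring. }
  assert (Hs : (-1) ^ n N = (-1) ^ k * (-1) ^ (n N - k)) by (rewrite <- pow_add; f_equal; lia).
  assert (Hs2 := pow_opp1_sqr (n N - k)).
  rewrite Hqpow, Hs.
  assert (Hq1 : q ^ k <> 0) by (apply pow_nonzero; lra).
  assert (Hq2 : q ^ n N <> 0) by (apply pow_nonzero; lra).
  assert (Hq3 : q ^ (N - (n N - k)) <> 0) by (apply pow_nonzero; lra).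
  transitivity (gbinom x k * gbinom (INR N - x) (n N - k) * q ^ k * p ^ (n N - k)
                * Rpower (INR N) (x + 1) * (-1) ^ k * ((-1) ^ (n N - k) * (-1) ^ (n N - k))); [ring |].
  rewrite Hs2. field. repeat split; try assumption; lra.
Qed.

Lemma bulk_fst {F : (nat -> Prop) -> Prop} {FF : Filter F} p :
  filter_le F eventually -> filterlim fst (bulk F p) eventually.
Proof.
  intros HF P HP. exists 1. split; [lra |]. generalize (HF P HP).
  apply filter_imp. intros N HN j _ _. exact HN.
Qed.

Lemma bulk_ratio {F : (nat -> Prop) -> Prop} {FF : Filter F} p :
  filter_le F eventually ->
  filterlim (fun Nj : nat * nat => INR (snd Nj) / INR (fst Nj)) (bulk F p) (locally p).
Proof.
  intros HF. apply flim_eps. intros eps. exists (eps / 2).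
  split; [generalize (cond_pos eps); lra |].
  generalize (HF _ (eventually_INR_gt 0)). apply filter_imp. intros N HN j _ Hj; simpl.
  replace (INR j / INR N - p) with ((INR j - p * INR N) / INR N) by (field; lra).
  unfold Rdiv. rewrite Rabs_mult, Rabs_inv, (Rabs_pos_eq (INR N)) by lra.
  apply Rle_lt_trans with (eps / 2 * INR N * / INR N).
  - apply Rmult_le_compat_r; [apply Rlt_le, Rinv_0_lt_compat |]; lra.
  - rewrite Rmult_assoc, Rinv_r by lra. generalize (cond_pos eps). lra.
Qed.

(** Factor by factor, with [n - j] and [N - j] both tending to infinity; the constant
    of [gbinom_pred_asymptotic] cancels, so it has to be nonzero. *)
Lemma averaged_term_limit {F : (nat -> Prop) -> Prop} {FF : Filter F} (p x z : R) (n : nat -> nat) :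
  0 < p -> p < z < 1 -> 0 < x -> sin (PI * x) <> 0 ->
  filter_le F eventually -> F (fun N => INR (n N) = z * INR N) ->
  filterlim (averaged_term x n) (bulk F p)
    (locally (- (Gamma (x + 1) * sin (PI * x) / PI) * Rpower (z - p) (- (x + 1)) * Rpower (1 - p) x)).
Proof.
  intros Hp Hz Hx Hsin HF Hn. assert (HPI := PI_RGT_0).
  destruct (gauss_product x ltac:(lra)) as [HG _].
  set (L := Gamma (x + 1) * sin (PI * x) / PI).
  set (c := Gamma (x + 1) * sin (PI * x) / (PI * x)).
  assert (Hc : c <> 0).
  { unfold c, Rdiv. repeat apply Rmult_integral_contrapositive_currified; try assumption; [lra |].
    apply Rinv_neq_0_compat, Rmult_integral_contrapositive_currified; lra. }
  set (u := fun k => (-1) ^ k * gbinom x k * Rpower (INR k) (x + 1)).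
  set (v := fun M => (-1) ^ M * gbinom (x - 1) M * Rpower (INR M) x).
  assert (Hu : is_lim_seq u (- L)) by exact (gbinom_asymptotic x Hx).
  assert (Hv : is_lim_seq v c) by exact (gbinom_pred_asymptotic x Hx).
  assert (Hfst := bulk_fst p HF). assert (Hrat := bulk_ratio p HF).
  (* inside a window of half-width [(z - p) / 2] the index stays below [n] *)
  assert (Hwin : bulk F p (fun Nj => INR (n (fst Nj)) = z * INR (fst Nj) /\ (snd Nj <= n (fst Nj))%nat
            /\ (n (fst Nj) <= fst Nj)%nat
            /\ (z - p) / 2 * INR (fst Nj) <= INR (n (fst Nj) - snd Nj)
            /\ (z - p) / 2 * INR (fst Nj) <= INR (fst Nj - snd Nj)
            /\ 0 < INR (fst Nj))).
  { exists ((z - p) / 2). split; [lra |].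
    generalize (filter_and _ _ Hn (HF _ (eventually_INR_gt 0))).
    apply filter_imp. intros N [HN HN0] j Hj Hd; simpl. apply Rabs_le_between in Hd.
    assert (Hjn : (j <= n N)%nat) by (apply INR_le; nra).
    assert (HnN : (n N <= N)%nat) by (apply INR_le; nra).
    rewrite !minus_INR by lia. repeat split; try assumption; nra. }
  assert (Hnj : filterlim (fun Nj => (n (fst Nj) - snd Nj)%nat) (bulk F p) eventually).
  { apply (flim_nat_infty _ fst ((z - p) / 2)); [lra | exact Hfst |].
    revert Hwin. apply filter_imp. tauto. }
  assert (HNj : filterlim (fun Nj : nat * nat => (fst Nj - snd Nj)%nat) (bulk F p) eventually).
  { apply (flim_nat_infty _ fst ((z - p) / 2)); [lra | exact Hfst |].
    revert Hwin. apply filter_imp. tauto. }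
  assert (HvNj := flim_seq v _ c Hv HNj).
  assert (Hzp : 0 < z - p) by lra. assert (Hp1 : 0 < 1 - p) by lra.
  assert (H1 := flim_mult _ _ _ _ (flim_mult _ _ _ _ (flim_mult _ _ _ _
      (flim_seq u _ (- L) Hu Hnj) (flim_div _ _ _ _ Hc (flim_seq v _ c Hv Hfst) HvNj))
      (flim_Rpower _ (z - p) (- (x + 1)) Hzp (flim_minus _ _ _ _ (filterlim_const z) Hrat)))
      (flim_Rpower _ (1 - p) x Hp1 (flim_minus _ _ _ _ (filterlim_const 1) Hrat))).
  rewrite Rdiv_diag, Rmult_1_r in H1 by exact Hc.
  revert H1. apply flim_ext.
  assert (Hbig : bulk F p (fun Nj => 0 < INR (n (fst Nj) - snd Nj)) ) by exact (Hnj _ (eventually_INR_gt 0)).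
  assert (Hbig2 : bulk F p (fun Nj : nat * nat => 0 < INR (fst Nj - snd Nj))) by exact (HNj _ (eventually_INR_gt 0)).
  generalize (filter_and _ _ (filter_and _ _ Hwin (flim_neq0 _ _ Hc HvNj)) (filter_and _ _ Hbig Hbig2)).
  apply filter_imp. intros [N j]; simpl fst; simpl snd.
  intros [[[HnN [Hjn [HnN' [_ [_ HN]]]]] Hvnz] [Hb1 Hb2]].
  unfold averaged_term. rewrite (proj2 (Nat.leb_le j (n N)) Hjn).
  assert (Hg := gbinom_INR_pos N j ltac:(lia)).
  assert (Hr := gbinom_shift_ratio x N j ltac:(lia)).
  unfold u, v in *.
  assert (Hphi : (-1) ^ (N - j) * gbinom (x - 1) (N - j) <> 0).
  { intros E. apply Hvnz. rewrite E. ring. }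
  assert (Hpw : forall a b, Rpower a b <> 0) by (intros; apply Rgt_not_eq, exp_pos).
  replace (gbinom (INR N - x) j / gbinom (INR N) j)
    with ((-1) ^ N * gbinom (x - 1) N / ((-1) ^ (N - j) * gbinom (x - 1) (N - j))).
  2: { apply (Rmult_eq_reg_r (gbinom (INR N) j * ((-1) ^ (N - j) * gbinom (x - 1) (N - j)))).
       - transitivity (gbinom (INR N) j * ((-1) ^ N * gbinom (x - 1) N)).
         + set (t := (-1) ^ (N - j) * gbinom (x - 1) (N - j)) in *. field. exact Hphi.
         + rewrite <- Hr. field. lra.
       - apply Rmult_integral_contrapositive_currified; [lra | exact Hphi]. }
  replace (z - INR j / INR N) with (INR (n N - j) / INR N).
  2: { rewrite minus_INR, HnN by lia. field. lra. }
  replace (1 - INR j / INR N) with (INR (N - j) / INR N).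
  2: { rewrite minus_INR by lia. field. lra. }
  rewrite !Rpower_div, !Rpower_Ropp by assumption.
  set (t := (-1) ^ (N - j) * gbinom (x - 1) (N - j)) in *.
  field. repeat split; try exact Hphi; apply Hpw.
Qed.

Lemma gbinom_bounded x : 0 < x -> exists B, forall k, Rabs (gbinom x k) <= B.
Proof.
  intros Hx.
  destruct (filterlim_bounded (V := R_NormedModule)
    (fun k => (-1) ^ k * gbinom x k * Rpower (INR k) (x + 1))) as [B HB].
  { eexists. exact (gbinom_asymptotic x Hx). }
  exists (B + 1). intros k.
  assert (HBk := HB k). unfold norm in HBk; simpl in HBk. unfold abs in HBk; simpl in HBk.
  rewrite !Rabs_mult, pow_1_abs, Rmult_1_l in HBk.
  destruct k as [| k].
  - assert (H0 := Rabs_pos (gbinom x 0 * Rpower (INR 0) (x + 1))). rewrite Rabs_mult in H0.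
    unfold gbinom at 1. simpl. rewrite Rdiv_diag, Rabs_R1 by lra. lra.
  - assert (Hk : 1 <= INR (S k)) by (apply (le_INR 1); lia).
    assert (Hp : 1 <= Rabs (Rpower (INR (S k)) (x + 1))).
    { rewrite Rabs_pos_eq by (apply Rlt_le, exp_pos).
      apply Rle_trans with (Rpower (INR (S k)) 0); [rewrite Rpower_O | apply Rle_Rpower]; lra. }
    assert (H0 := Rabs_pos (gbinom x (S k))). nra.
Qed.

Lemma gbinom_shift_ratio_le x N j :
  0 < x -> (j <= N)%nat -> x <= INR (N - j) ->
  0 <= gbinom (INR N - x) j <= gbinom (INR N) j.
Proof.
  intros Hx. induction j as [| j IH]; intros Hj HxN.
  - unfold gbinom; simpl. lra.
  - rewrite minus_INR, S_INR in HxN by exact Hj.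
    destruct IH as [IH0 IH1]; [lia | rewrite minus_INR by lia; lra |].
    rewrite !gbinom_succ. assert (Hj0 := pos_INR j).
    assert (Hi : 0 < / (INR j + 1)) by (apply Rinv_0_lt_compat; lra).
    unfold Rdiv. split.
    + apply Rmult_le_pos; [apply Rmult_le_pos |]; lra.
    + apply Rmult_le_compat_r; [lra |]. apply Rmult_le_compat; lra.
Qed.

(** Polynomial growth suffices for [binomial_concentration]; for large [N] one has
    [x <= N - n], which keeps every factor of the ratio of binomials in [[0, 1]]. *)
Lemma averaged_term_bound {F : (nat -> Prop) -> Prop} {FF : Filter F} (x z : R) (n : nat -> nat) :
  0 < z < 1 -> 0 < x -> filter_le F eventually -> F (fun N => INR (n N) = z * INR N) ->
  exists B, F (fun N => forall j, (j <= N)%nat ->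
    Rabs (averaged_term x n (N, j)) <= B * Rpower (INR N) (x + 1)).
Proof.
  intros Hz Hx HF Hn. destruct (gbinom_bounded x Hx) as [B HB]. exists B.
  assert (HB0 : 0 <= B) by (apply Rle_trans with (2 := HB 0%nat), Rabs_pos).
  generalize (filter_and _ _ Hn (HF _ (eventually_INR_gt (x / (1 - z))))).
  apply filter_imp. intros N [HN HNx] j Hj.
  assert (Hpw : 0 < Rpower (INR N) (x + 1)) by apply exp_pos.
  unfold averaged_term. destruct (Nat.leb_spec j (n N)) as [Hjn | Hjn].
  - apply (Rmult_lt_compat_l (1 - z)) in HNx; [| lra].
    replace ((1 - z) * (x / (1 - z))) with x in HNx by (field; lra).
    destruct (gbinom_shift_ratio_le x N j Hx Hj) as [H0 H1].
    { rewrite minus_INR by exact Hj. apply le_INR in Hjn. lra. }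
    assert (Hg := gbinom_INR_pos N j Hj).
    rewrite !Rabs_mult, pow_1_abs, Rmult_1_l, (Rabs_pos_eq (Rpower _ _)) by lra.
    rewrite (Rabs_pos_eq (_ / _)) by (apply Rdiv_le_0_compat; assumption).
    assert (Hr : gbinom (INR N - x) j / gbinom (INR N) j <= 1).
    { apply (Rmult_le_reg_r (gbinom (INR N) j)); [exact Hg |].
      unfold Rdiv. rewrite Rmult_assoc, Rinv_l; lra. }
    assert (Hr0 : 0 <= gbinom (INR N - x) j / gbinom (INR N) j) by (apply Rdiv_le_0_compat; assumption).
    rewrite <- (Rmult_1_r (B * _)), (Rmult_comm B).
    apply Rmult_le_compat; try lra.
    + apply Rmult_le_pos; [lra | apply Rabs_pos].
    + apply Rmult_le_compat_l; [lra | apply HB].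
  - rewrite Rabs_R0. apply Rmult_le_pos; lra.
Qed.

Lemma pow_exp_ln q k : 0 < q -> q ^ k = exp (INR k * ln q).
Proof. intros Hq. rewrite <- (exp_ln q Hq) at 1. apply exp_pow. Qed.

Lemma krawtchouk_rescaled_limit {F : (nat -> Prop) -> Prop} {FF : Filter F} (p q x z : R) (n : nat -> nat) :
  0 < p -> 0 < q -> p + q = 1 -> p < z < 1 -> 0 < x -> sin (PI * x) <> 0 ->
  filter_le F eventually -> F (fun N => INR (n N) = z * INR N) ->
  filterlim (fun N => (-1) ^ n N * krawtchouk p q (n N) N x * Rpower (INR N) (x + 1)
                      / exp (INR N * ((z - 1) * ln q)))
    F (locally (- (Gamma (x + 1) * sin (PI * x) / PI) * Rpower (z - p) (- (x + 1)) * Rpower q x)).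
Proof.
  intros Hp Hq Hpq Hz Hx Hsin HF Hn.
  assert (Hz0 : 0 < z) by lra. assert (Hx1 : 0 < x + 1) by lra.
  destruct (averaged_term_bound x z n (conj Hz0 (proj2 Hz)) Hx HF Hn) as [B HB].
  assert (Hlim := averaged_term_limit p x z n Hp Hz Hx Hsin HF Hn).
  replace (1 - p) with q in Hlim by lra.
  assert (H := binomial_concentration p q _ _ B (x + 1) Hp Hq Hpq HF Hlim Hx1 HB).
  revert H. apply flim_ext.
  generalize (filter_and _ _ Hn (HF _ (eventually_INR_gt 0))).
  apply filter_imp. intros N [HnN HN].
  assert (Hle : (n N <= N)%nat) by (apply INR_le; nra).
  rewrite krawtchouk_as_average by assumption.
  assert (E : q ^ n N / q ^ N = exp (INR N * ((z - 1) * ln q))).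
  { rewrite !pow_exp_ln by exact Hq. unfold Rdiv. rewrite <- exp_Ropp, <- exp_plus. f_equal.
    rewrite HnN. ring. }
  rewrite E. field. apply Rgt_not_eq, exp_pos.
Qed.

(** * The finite sum when [x] is a natural number *)

Lemma gbinom_pred a j : a * gbinom (a - 1) j = (a - INR j) * gbinom a j.
Proof.
  rewrite <- gbinom_absorb, gbinom_succ. assert (Hj := pos_INR j). field. lra.
Qed.

Lemma flim_inv_INR {F : (nat -> Prop) -> Prop} a :
  filter_le F eventually -> Filter F -> filterlim (fun N => a / INR N) F (locally 0).
Proof.
  intros HF FF. replace 0 with (a * 0) by ring.
  apply flim_mult; [apply filterlim_const |].
  apply (filterlim_filter_le_1 (F := eventually)); [exact HF | exact lim_inv_INR].
Qed.

(** Each unit taken from the upper index costs a factor [1 - z], each unit taken from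
    the lower one a factor [z / (1 - z)]. *)
Lemma gbinom_neighbour_ratio {F : (nat -> Prop) -> Prop} {FF : Filter F} (z : R) (n : nat -> nat) m k :
  0 < z < 1 -> filter_le F eventually -> F (fun N => INR (n N) = z * INR N) ->
  filterlim (fun N => gbinom (INR N - INR m) (n N - k) / gbinom (INR N) (n N))
    F (locally ((1 - z) ^ m * (z / (1 - z)) ^ k)).
Proof.
  intros Hz HF Hn.
  assert (Hlin : forall a b, filterlim (fun N => a + b / INR N) F (locally a)).
  { intros a b. rewrite <- (Rplus_0_r a) at 1.
    apply flim_plus; [apply filterlim_const | apply flim_inv_INR; assumption]. }
  assert (Hlarge : forall i, F (fun N => INR (n N) = z * INR N /\ (i <= n N)%nat /\ (n N <= N)%nat
                                  /\ INR i < INR N)).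
  { intros i. generalize (filter_and _ _ Hn (filter_and _ _ (HF _ (eventually_INR_gt (INR i / z)))
                            (HF _ (eventually_INR_gt (INR i))))).
    apply filter_imp. intros N [HnN [HN HNi]]. assert (Hi := pos_INR i).
    apply (Rmult_lt_compat_l z) in HN; [| lra].
    replace (z * (INR i / z)) with (INR i) in HN by (field; lra).
    repeat split; try assumption; apply INR_le; nra. }
  assert (Hz1 : 1 - z <> 0) by lra.
  induction m as [| m IHm].
  - simpl pow. rewrite Rmult_1_l. induction k as [| k IHk].
    + apply (flim_ext (fun _ => 1)); [| apply filterlim_const].
      generalize (Hlarge 0%nat). apply filter_imp. intros N [_ [_ [HN _]]].
      simpl. rewrite Rminus_0_r, Nat.sub_0_r. field.
      apply Rgt_not_eq, gbinom_INR_pos, HN.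
    + assert (H := flim_mult _ _ _ _ (flim_div _ _ _ (1 - z) Hz1 (Hlin z (- INR k))
                     (Hlin (1 - z) (INR k + 1))) IHk).
      simpl pow. revert H. apply flim_ext.
      generalize (Hlarge (S k)). apply filter_imp. intros N [HnN [Hk [HN HkN]]].
      assert (Hk0 := pos_INR k).
      simpl INR. rewrite Rminus_0_r.
      assert (HN0 : 0 < INR N) by (generalize (pos_INR (S k)); lra).
      replace (n N - k)%nat with (S (n N - S k)) by lia.
      rewrite gbinom_succ.
      assert (E : INR (n N - S k) = z * INR N - INR k - 1).
      { rewrite minus_INR, S_INR, HnN by lia. ring. }
      assert (Hpos : 0 <= INR (n N - S k)) by apply pos_INR.
      rewrite E in Hpos |- *.
      assert (Hg := gbinom_INR_pos N (n N) HN).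
      field. repeat split; try lra. nra.
  - assert (H := flim_mult _ _ _ _ (flim_div _ _ _ 1 R1_neq_R0 (Hlin (1 - z) (INR k - INR m))
                   (Hlin 1 (- INR m))) IHm).
    replace ((1 - z) / 1 * ((1 - z) ^ m * (z / (1 - z)) ^ k))
      with ((1 - z) ^ S m * (z / (1 - z)) ^ k) in H by (simpl; field; lra).
    revert H. apply flim_ext.
    generalize (filter_and _ _ (Hlarge k) (HF _ (eventually_INR_gt (INR m)))).
    apply filter_imp. intros N [[HnN [Hk [HN HkN]]] HmN].
    assert (Hm0 := pos_INR m).
    assert (Hp := gbinom_pred (INR N - INR m) (n N - k)).
    replace (INR N - INR m - 1) with (INR N - INR (S m)) in Hp by (rewrite S_INR; ring).
    rewrite minus_INR, HnN in Hp by lia.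
    assert (Hg := gbinom_INR_pos N (n N) HN).
    replace (gbinom (INR N - INR (S m)) (n N - k))
      with ((INR N - INR m - (z * INR N - INR k)) * gbinom (INR N - INR m) (n N - k) / (INR N - INR m)).
    2: { rewrite <- Hp. field. lra. }
    field. repeat split; lra.
Qed.

Lemma flim_sum {T} {F : (T -> Prop) -> Prop} {FF : Filter F} (f : nat -> T -> R) (l : nat -> R) m :
  (forall k, (k <= m)%nat -> filterlim (f k) F (locally (l k))) ->
  filterlim (fun t => sum_f_R0 (fun k => f k t) m) F (locally (sum_f_R0 l m)).
Proof.
  induction m as [| m IH]; intros H; simpl.
  - apply H; lia.
  - apply flim_plus; [apply IH; intros k Hk; apply H; lia | apply H; lia].
Qed.

Lemma falling_INR_0 m k : (m < k)%nat -> falling (INR m) k = 0.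
Proof.
  induction k as [| k IH]; intros Hk; [lia |]. simpl.
  destruct (Nat.eq_dec m k) as [-> | Hne]; [ring |]. rewrite IH by lia. ring.
Qed.

(** Only [k <= m] contributes, and the limits of the summands add up to
    [((1 - z) - z q / p)^m] by the binomial theorem. *)
Lemma krawtchouk_integer_ratio {F : (nat -> Prop) -> Prop} {FF : Filter F} (p q z : R) (m : nat) (n : nat -> nat) :
  0 < p -> 0 < q -> p + q = 1 -> p < z < 1 ->
  filter_le F eventually -> F (fun N => INR (n N) = z * INR N) ->
  filterlim (fun N => krawtchouk p q (n N) N (INR m) / (gbinom (INR N) (n N) * (- p) ^ n N))
    F (locally (((p - z) / p) ^ m)).
Proof.
  intros Hp Hq Hpq Hz HF Hn.
  assert (Hpn : - p <> 0) by lra.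
  assert (Hlim : filterlim (fun N => sum_f_R0 (fun k => gbinom (INR m) k * (q / - p) ^ k
       * (gbinom (INR N - INR m) (n N - k) / gbinom (INR N) (n N))) m) F
     (locally (sum_f_R0 (fun k => gbinom (INR m) k * (q / - p) ^ k * ((1 - z) ^ m * (z / (1 - z)) ^ k)) m))).
  { apply (flim_sum (fun k N => gbinom (INR m) k * (q / - p) ^ k
       * (gbinom (INR N - INR m) (n N - k) / gbinom (INR N) (n N)))
       (fun k => gbinom (INR m) k * (q / - p) ^ k * ((1 - z) ^ m * (z / (1 - z)) ^ k))).
    intros k _. apply flim_mult; [apply filterlim_const |].
    apply gbinom_neighbour_ratio; try assumption; lra. }
  replace (((p - z) / p) ^ m)
    with (sum_f_R0 (fun k => gbinom (INR m) k * (q / - p) ^ k * ((1 - z) ^ m * (z / (1 - z)) ^ k)) m).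
  2: { replace ((p - z) / p) with (q / - p * z + (1 - z)) by (replace q with (1 - p) by lra; field; lra).
       rewrite binomial. apply sum_eq. intros k Hk.
       rewrite gbinom_INR by exact Hk.
       replace ((1 - z) ^ m) with ((1 - z) ^ k * (1 - z) ^ (m - k)) by (rewrite <- pow_add; f_equal; lia).
       rewrite Rpow_mult_distr. unfold Rdiv at 2. rewrite Rpow_mult_distr, pow_inv.
       field. apply pow_nonzero. lra. }
  revert Hlim. apply flim_ext.
  generalize (filter_and _ _ Hn (HF _ (eventually_INR_gt (INR m / z)))).
  apply filter_imp. intros N [HnN HN].
  assert (Hm0 := pos_INR m).
  apply (Rmult_lt_compat_l z) in HN; [| lra].
  replace (z * (INR m / z)) with (INR m) in HN by (field; lra).
  assert (Hmn : (m <= n N)%nat) by (apply INR_le; lra).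
  assert (HnN' : (n N <= N)%nat) by (apply INR_le; nra).
  unfold krawtchouk. rewrite (sum_f_R0_truncate _ m (n N) Hmn).
  2: { intros k Hk. unfold gbinom at 1. rewrite falling_INR_0 by lia. unfold Rdiv. ring. }
  unfold Rdiv at 3. rewrite Rmult_comm, scal_sum. apply sum_eq. intros k Hk.
  assert (Hg := gbinom_INR_pos N (n N) HnN').
  replace ((- p) ^ n N) with ((- p) ^ k * (- p) ^ (n N - k)) by (rewrite <- pow_add; f_equal; lia).
  unfold Rdiv at 1. rewrite Rpow_mult_distr, pow_inv.
  field. repeat split; try (apply pow_nonzero; exact Hpn). lra.
Qed.

(** * The two terms of the expansion as real numbers *)

(** Up to the sign [(-1)^n], the contribution of the saddle point of the generating
    function [(1 + q w)^x (1 - p w)^(N - x)]. *)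
Definition saddle_term (p x z N : R) : R :=
  sqrt (1 / N) / (sqrt (2 * PI) * sqrt (z * (1 - z))) * cos (PI * x) * Rpower ((z - p) / p) x
  * exp (N * ((z - 1) * ln (1 - z) - z * ln z + z * ln p)).

(** Up to the sign [(-1)^n], the contribution of the branch point [w = - 1 / q]. *)
Definition branch_term (p q x z N : R) : R :=
  1 / N / PI * (Gamma (x + 1) / (z - p)) * sin (PI * x) * Rpower (q * (1 / N) / (z - p)) x
  * exp (N * ((z - 1) * ln q)).

Lemma cos_INR_PI m : cos (INR m * PI) = (-1) ^ m.
Proof.
  induction m as [| m IH].
  - simpl. rewrite Rmult_0_l. apply cos_0.
  - rewrite S_INR, Rmult_plus_distr_r, Rmult_1_l, neg_cos, IH. simpl. ring.
Qed.

Lemma sin_INR_PI m : sin (INR m * PI) = 0.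
Proof.
  induction m as [| m IH].
  - simpl. rewrite Rmult_0_l. apply sin_0.
  - rewrite S_INR, Rmult_plus_distr_r, Rmult_1_l, neg_sin, IH. ring.
Qed.

Lemma Cexp_INR_PI a m : Cexp (a, INR m * PI) = RtoC ((-1) ^ m * exp a).
Proof.
  unfold Cexp, RtoC; simpl. rewrite cos_INR_PI, sin_INR_PI. f_equal; ring.
Qed.

Lemma krawtchouk_asymptotic_real p q x z N m :
  0 < N -> INR m = z * N ->
  krawtchouk_asymptotic p q x z (1 / N)
  = RtoC ((-1) ^ m * (saddle_term p x z N - branch_term p q x z N)).
Proof.
  intros HN Hm.
  assert (HN1 : 1 / N <> 0) by (apply Rgt_not_eq, Rdiv_lt_0_compat; lra).
  assert (E1 : (phi0 p z / RtoC (1 / N))%C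
               = (N * ((z - 1) * ln (1 - z) - z * ln z + z * ln p), INR m * PI)).
  { unfold Cdiv. rewrite <- RtoC_inv by exact HN1.
    unfold phi0, ln_opp. rewrite Hm. apply injective_projections; simpl; field; lra. }
  assert (E2 : ((RtoC ((z - 1) * ln q) + RtoC PI * Ci * RtoC z) / RtoC (1 / N))%C
               = (N * ((z - 1) * ln q), INR m * PI)).
  { unfold Cdiv. rewrite <- RtoC_inv by exact HN1.
    rewrite Hm. apply injective_projections; simpl; field; lra. }
  unfold krawtchouk_asymptotic. rewrite E1, E2, !Cexp_INR_PI.
  rewrite <- !RtoC_mult, <- RtoC_minus. f_equal.
  unfold saddle_term, branch_term. ring.
Qed.

(** Gibbs's inequality for the Bernoulli laws of parameters [z] and [p]. *)
Lemma saddle_exponent_lt p q z :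
  0 < p -> 0 < q -> p + q = 1 -> p < z < 1 ->
  (z - 1) * ln (1 - z) - z * ln z + z * ln p < (z - 1) * ln q.
Proof.
  intros Hp Hq Hpq Hz.
  assert (H1 := exp_ineq1 (ln (p / z))). assert (H2 := exp_ineq1_le (ln (q / (1 - z)))).
  rewrite exp_ln in H1 by (apply Rdiv_lt_0_compat; lra).
  rewrite exp_ln in H2 by (apply Rdiv_lt_0_compat; lra).
  rewrite ln_div in H1 by lra. rewrite ln_div in H2 by lra.
  assert (Hln : ln p < ln z) by (apply ln_increasing; lra).
  specialize (H1 ltac:(lra)).
  apply (Rmult_lt_compat_l z) in H1; [| lra].
  apply (Rmult_le_compat_l (1 - z)) in H2; [| lra].
  replace (z * (p / z)) with p in H1 by (field; lra).
  replace ((1 - z) * (q / (1 - z))) with q in H2 by (field; lra).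
  lra.
Qed.

Lemma flim_RtoC {T} {F : (T -> Prop) -> Prop} {FF : Filter F} (f : T -> R) (l : R) :
  filterlim f F (locally l) -> filterlim (fun t => RtoC (f t)) F (locally (RtoC l)).
Proof.
  intros Hf. apply (filterlim_locally (fun t => RtoC (f t)) (RtoC l)). intros eps.
  generalize (proj1 (filterlim_locally f l) Hf eps).
  apply filter_imp. intros t Ht. split; [exact Ht | apply ball_center].
Qed.

Lemma nonneg_integer_of_sin_0 x : 0 <= x -> sin (PI * x) = 0 -> exists m, x = INR m.
Proof.
  intros Hx Hs. assert (HPI := PI_RGT_0).
  destruct (sin_eq_0_0 _ Hs) as [k Hk].
  assert (E : x = IZR k).
  { apply (Rmult_eq_reg_l PI); [rewrite Hk; ring | lra]. }
  exists (Z.to_nat k). rewrite INR_IZR_INZ, Z2Nat.id; [exact E |].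
  apply le_IZR. lra.
Qed.

(** Here [sin (PI m) = 0] removes the branch-point term, and [cos (PI m) = (-1)^m]
    accounts for the sign of [(p - z)^m]. *)
Lemma ratio_limit_integer {F : (nat -> Prop) -> Prop} {FF : Filter F} (p q z : R) (m : nat) (n : nat -> nat) :
  0 < p -> 0 < q -> p + q = 1 -> p < z < 1 ->
  filter_le F eventually -> F (fun N => INR (n N) = z * INR N) ->
  filterlim (fun N => krawtchouk p q (n N) N (INR m)
      / ((-1) ^ n N * (saddle_term p (INR m) z (INR N) - branch_term p q (INR m) z (INR N))))
    F (locally 1).
Proof.
  intros Hp Hq Hpq Hz HF Hn. assert (HPI := PI_RGT_0).
  set (r := ((z - p) / p) ^ m).
  assert (Hr : 0 < r) by (apply pow_lt, Rdiv_lt_0_compat; lra).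
  assert (Hsgn : ((p - z) / p) ^ m = (-1) ^ m * r).
  { unfold r. rewrite <- Rpow_mult_distr. f_equal. field. lra. }
  assert (Hsm : (-1) ^ m * r <> 0).
  { apply Rmult_integral_contrapositive_currified; [apply pow_nonzero |]; lra. }
  assert (Hz0 : 0 < z < 1) by lra.
  assert (H := flim_mult _ _ _ _ (central_binomial_asymptotic z n Hz0 HF Hn)
     (flim_div _ _ _ _ Hsm (krawtchouk_integer_ratio p q z m n Hp Hq Hpq Hz HF Hn)
        (filterlim_const ((-1) ^ m * r)))).
  rewrite Hsgn, Rdiv_diag, Rmult_1_r in H by exact Hsm.
  revert H. apply flim_ext.
  generalize (filter_and _ _ Hn (HF _ (eventually_INR_gt 0))).
  apply filter_imp. intros N [HnN HN].
  assert (HnN' : (n N <= N)%nat) by (apply INR_le; nra).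
  assert (Hg := gbinom_INR_pos N (n N) HnN').
  unfold saddle_term, branch_term.
  replace (PI * INR m) with (INR m * PI) by ring.
  rewrite sin_INR_PI, cos_INR_PI, Rpower_pow by (apply Rdiv_lt_0_compat; lra). fold r.
  replace (exp (INR N * ((z - 1) * ln (1 - z) - z * ln z + z * ln p)))
    with (exp (INR N * ((z - 1) * ln (1 - z) - z * ln z)) * p ^ n N).
  2: { rewrite pow_exp_ln, <- exp_plus by exact Hp. f_equal. rewrite HnN. ring. }
  replace ((- p) ^ n N) with ((-1) ^ n N * p ^ n N)
    by (rewrite <- Rpow_mult_distr; f_equal; ring).
  assert (Hsq : forall a, 0 < a -> sqrt a <> 0) by (intros; apply Rgt_not_eq, sqrt_lt_R0; assumption).
  assert (N1 : sqrt (1 / INR N) <> 0) by (apply Hsq, Rdiv_lt_0_compat; lra).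
  assert (N2 : sqrt (2 * PI) <> 0) by (apply Hsq; lra).
  assert (N3 : sqrt (z * (1 - z)) <> 0) by (apply Hsq, Rmult_lt_0_compat; lra).
  assert (N4 : exp (INR N * ((z - 1) * ln (1 - z) - z * ln z)) <> 0) by (apply Rgt_not_eq, exp_pos).
  assert (N5 : p ^ n N <> 0) by (apply pow_nonzero; lra).
  assert (N6 : (-1) ^ n N <> 0) by (apply pow_nonzero; lra).
  assert (N7 : (-1) ^ m <> 0) by (apply pow_nonzero; lra).
  rewrite Rmult_0_r, !Rmult_0_l, Rminus_0_r.
  field. repeat split; try assumption; lra.
Qed.

(** Multiplied by [N^(x+1) / q^(n-N)], the branch-point term is constant and the
    saddle-point term decays exponentially. *)
Lemma ratio_limit_noninteger {F : (nat -> Prop) -> Prop} {FF : Filter F} (p q x z : R) (n : nat -> nat) :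
  0 < p -> 0 < q -> p + q = 1 -> p < z < 1 -> 0 < x -> sin (PI * x) <> 0 ->
  filter_le F eventually -> F (fun N => INR (n N) = z * INR N) ->
  filterlim (fun N => krawtchouk p q (n N) N x
      / ((-1) ^ n N * (saddle_term p x z (INR N) - branch_term p q x z (INR N))))
    F (locally 1).
Proof.
  intros Hp Hq Hpq Hz Hx Hsin HF Hn. assert (HPI := PI_RGT_0).
  destruct (gauss_product x ltac:(lra)) as [HG _].
  set (l := - (Gamma (x + 1) * sin (PI * x) / PI) * Rpower (z - p) (- (x + 1)) * Rpower q x).
  assert (Hpw : forall a b, Rpower a b <> 0) by (intros; apply Rgt_not_eq, exp_pos).
  assert (Hl : l <> 0).
  { unfold l, Rdiv. repeat apply Rmult_integral_contrapositive_currified; try apply Hpw.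
    apply Ropp_neq_0_compat. repeat apply Rmult_integral_contrapositive_currified; try assumption; [lra |].
    apply Rinv_neq_0_compat; lra. }
  assert (HK := krawtchouk_rescaled_limit p q x z n Hp Hq Hpq Hz Hx Hsin HF Hn). fold l in HK.
  set (a := (z - 1) * ln (1 - z) - z * ln z + z * ln p).
  set (b := (z - 1) * ln q).
  assert (Hab : 0 < b - a) by (generalize (saddle_exponent_lt p q z Hp Hq Hpq Hz); unfold a, b; lra).
  set (c := / (sqrt (2 * PI) * sqrt (z * (1 - z))) * cos (PI * x) * Rpower ((z - p) / p) x).
  assert (Hdecay : filterlim (fun N => c * (Rpower (INR N) (x + / 2) * exp (- ((b - a) * INR N)))) F (locally (c * 0))).
  { apply flim_mult; [apply filterlim_const |].
    apply (filterlim_filter_le_1 (F := eventually)); [exact HF |].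
    apply power_exp_decay; lra. }
  assert (HD : filterlim (fun N => (saddle_term p x z (INR N) - branch_term p q x z (INR N))
                   * Rpower (INR N) (x + 1) / exp (INR N * b)) F (locally l)).
  { assert (H := flim_plus _ _ _ _ Hdecay (filterlim_const l)). rewrite Rmult_0_r, Rplus_0_l in H.
    revert H. apply flim_ext. generalize (HF _ (eventually_INR_gt 0)).
    apply filter_imp. intros N HN.
    assert (Hs : saddle_term p x z (INR N) * Rpower (INR N) (x + 1) / exp (INR N * b)
                 = c * (Rpower (INR N) (x + / 2) * exp (- ((b - a) * INR N)))).
    { unfold saddle_term. fold a.
      replace (sqrt (1 / INR N)) with (Rpower (INR N) (- / 2)).
      2: { rewrite <- Rpower_sqrt by (apply Rdiv_lt_0_compat; lra).
           rewrite Rpower_div, Rpower_Ropp by lra.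
           unfold Rpower at 2. rewrite ln_1, Rmult_0_r, exp_0. unfold Rdiv; ring. }
      replace (x + 1) with (x + / 2 + / 2) by field.
      rewrite (Rpower_plus (x + / 2) (/ 2)), Rpower_Ropp.
      replace (- ((b - a) * INR N)) with (INR N * a + - (INR N * b)) by ring.
      rewrite exp_plus, exp_Ropp. unfold c, Rdiv. field. 
      repeat split; try apply Hpw; try (apply Rgt_not_eq, exp_pos);
        apply Rgt_not_eq, sqrt_lt_R0; try apply Rmult_lt_0_compat; lra. }
    assert (Hb : branch_term p q x z (INR N) * Rpower (INR N) (x + 1) / exp (INR N * b) = - l).
    { unfold branch_term, l. fold b.
      replace (q * (1 / INR N) / (z - p)) with (q / (INR N * (z - p))) by (field; lra).
      assert (0 < INR N * (z - p)) by (apply Rmult_lt_0_compat; lra).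
      rewrite Rpower_div, <- Rpower_mult_distr, Rpower_Ropp, !Rpower_plus, !Rpower_1 by lra.
      field. repeat split; try apply Hpw; try (apply Rgt_not_eq, exp_pos); lra. }
    rewrite <- Hs. rewrite <- (Ropp_involutive l), <- Hb. field. apply Rgt_not_eq, exp_pos. }
  assert (H := flim_div _ _ _ _ Hl HK HD). rewrite Rdiv_diag in H by exact Hl.
  revert H. apply flim_ext. generalize (filter_and _ _ (flim_neq0 _ _ Hl HD) (HF _ (eventually_INR_gt 0))).
  apply filter_imp. intros N [HD0 HN].
  assert (Hnz : saddle_term p x z (INR N) - branch_term p q x z (INR N) <> 0).
  { intros E. apply HD0. rewrite E. unfold Rdiv; ring. }
  assert (Hsg : (-1) ^ n N <> 0) by (apply pow_nonzero; lra).
  assert (Hs2 := pow_opp1_sqr (n N)).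
  assert (He : exp (INR N * b) <> 0) by (apply Rgt_not_eq, exp_pos).
  replace (INR N * ((z - 1) * ln q)) with (INR N * b) by reflexivity.
  set (D := saddle_term p x z (INR N) - branch_term p q x z (INR N)) in *.
  set (K := krawtchouk p q (n N) N x).
  transitivity ((-1) ^ n N * (-1) ^ n N * K / ((-1) ^ n N * D)).
  - field. repeat split; try assumption; apply Hpw.
  - rewrite Hs2. field. split; assumption.
Qed.

(** * The expansion *)

(* The limit is along the integers N for which z * N is an integer, n N being
   that integer; the values of n at other N are irrelevant. *)
Theorem mainTheorem5 (p q x z : R)
    (hp : 0 < p < 1) (hq : 0 < q < 1) (hpq : p + q = 1)
    (hx : 0 <= x) (hz : p < z < 1) (n : nat -> nat) :
  filterlim
    (fun N : nat =>
       (RtoC (krawtchouk p q (n N) N x)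
        / krawtchouk_asymptotic p q x z (1 / INR N))%C)
    (within (fun N : nat => INR (n N) = z * INR N) eventually)
    (locally (RtoC 1)).
Proof.
  set (F := within (fun N : nat => INR (n N) = z * INR N) eventually).
  assert (FF : Filter F) by (apply within_filter; typeclasses eauto).
  assert (HF : filter_le F eventually) by apply filter_le_within.
  assert (Hn : F (fun N => INR (n N) = z * INR N)).
  { exists 0%nat. intros N _ H; exact H. }
  set (D := fun N => (-1) ^ n N * (saddle_term p x z (INR N) - branch_term p q x z (INR N))).
  assert (Hreal : filterlim (fun N => krawtchouk p q (n N) N x / D N) F (locally 1)).
  { destruct (Req_dec (sin (PI * x)) 0) as [Hs | Hs].
    - destruct (nonneg_integer_of_sin_0 x hx Hs) as [m Hm]. unfold D. rewrite Hm.
      apply ratio_limit_integer; tauto || lra.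
    - assert (Hx0 : 0 < x).
      { destruct hx as [H | <-]; [exact H |]. rewrite Rmult_0_r, sin_0 in Hs. lra. }
      apply ratio_limit_noninteger; tauto || lra. }
  apply (filterlim_ext_loc (fun N => RtoC (krawtchouk p q (n N) N x / D N))).
  2: exact (flim_RtoC _ _ Hreal).
  generalize (filter_and _ _ (filter_and _ _ Hn (HF _ (eventually_INR_gt 0))) (flim_neq0 _ _ R1_neq_R0 Hreal)).
  apply filter_imp. intros N [[HnN HN] HKD].
  rewrite (krawtchouk_asymptotic_real p q x z (INR N) (n N) HN HnN).
  apply RtoC_div.
  intros E. apply HKD. unfold D. rewrite E. unfold Rdiv. rewrite Rinv_0. ring.
Qed.
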